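(* Let $R$ be a commutative Noetherian ring with unity in which $2$ is invertible. Let $m\ge 3$ and let $\alpha\in\mathrm{SO}_{2m-1}(R)$ be homotopic to the identity. Then for all $\beta\in\mathrm{O}_{2m-1}(R)$, the commutator satisfies $[\alpha,\beta]\perp I_2\in\mathrm{EO}_{2m+1}(R)$.
   Context: For a commutative ring $A$ with $2$ invertible and matrix units $e_{i,j}$, put $\tilde\phi_{2r}=\sum_{i=1}^r(e_{2i-1,2i}+e_{2i,2i-1})$ and $\tilde\phi_{2r+1}=(2)\perp\tilde\phi_{2r}$, where $\perp$ denotes block diagonal sum. $\mathrm{O}_n(A)=\{\alpha\in\mathrm{GL}_n(A):\alpha^t\tilde\phi_n\alpha=\tilde\phi_n\}$, and $\mathrm{SO}_n(A)$ is its subgroup of matrices of determinant $1$. For $z\in A$ and $1\le i\le r$, writing $e_{k,l}(z)=z e_{k,l}$, set $$F^1_i(z)=I_{2r+1}+e_{1,2i+1}(z)-e_{2i,1}(2z)-e_{2i,2i+1}(z^2),$$ $$F^2_i(z)=I_{2r+1}+e_{1,2i}(z)-e_{2i+1,1}(2z)-e_{2i+1,2i}(z^2).$$ $\mathrm{EO}_{2r+1}(A)$ is the subgroup of $\mathrm{O}_{2r+1}(A)$ generated by all $F^1_i(z),F^2_i(z)$, $1\le i\le r$, $z\in A$. $\alpha\in\mathrm{SO}_{n}(R)$ is homotopic to the identity if there exists $\alpha(X)\in\mathrm{SO}_{n}(R[X])$ with $\alpha(0)=I_n$ and $\alpha(1)=\alpha$. *)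

(* Defs.v *)
From HB Require Import structures.
From mathcomp Require Import all_boot all_order all_algebra.

Set Implicit Arguments.
Unset Strict Implicit.
Unset Printing Implicit Defensive.

Import GRing.Theory.
Local Open Scope ring_scope.

Definition is_ideal (R : comNzRingType) (I : R -> Prop) : Prop :=
  [/\ I 0,
      forall x y, I x -> I y -> I (x + y)
    & forall a x, I x -> I (a * x)].

Definition noetherian (R : comNzRingType) : Prop :=
  forall I : R -> Prop, is_ideal I ->
    exists s : seq R, forall x : R,
      I x <-> exists c : 'I_(size s) -> R, x = \sum_(i < size s) c i * s`_i.

Definition perp (A : comNzRingType) (m n : nat) (M : 'M[A]_m) (N : 'M[A]_n)
  : 'M[A]_(m + n) := block_mx M 0 0 N.

(* Matrix unit with 1-based natural-number indices, [mxunit A n 1 1] being the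
   top left one; it is the zero matrix if an index lies outside 1..n. *)
Definition mxunit (A : comNzRingType) (n i j : nat) : 'M[A]_n :=
  \matrix_(k, l) ((k.+1 == i) && (l.+1 == j))%:R.

Definition phi_form_even (A : comNzRingType) (r : nat) : 'M[A]_(r.*2) :=
  \sum_(1 <= i < r.+1)
    (mxunit A r.*2 (2 * i - 1) (2 * i) + mxunit A r.*2 (2 * i) (2 * i - 1)).

(* Both parities at once: [odd n], read as a number, is the size of the scalar
   block 2, so that block is (2) for n odd and empty for n even. *)
Definition phi_form (A : comNzRingType) (n : nat) : 'M[A]_n :=
  castmx (odd_double_half n, odd_double_half n)
    (perp (2%:M : 'M[A]_(odd n)) (phi_form_even A n./2)).

(* [unitmx] is not available here: {poly R} has no unitRingType structure unless
   R is an integral domain. *)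
Definition in_GL (A : comNzRingType) (n : nat) (M : 'M[A]_n) : Prop :=
  exists N : 'M[A]_n, M *m N = 1%:M /\ N *m M = 1%:M.

Definition in_O (A : comNzRingType) (n : nat) (M : 'M[A]_n) : Prop :=
  in_GL M /\ M^T *m phi_form A n *m M = phi_form A n.

Definition in_SO (A : comNzRingType) (n : nat) (M : 'M[A]_n) : Prop :=
  in_O M /\ \det M = 1.

Definition F1 (A : comNzRingType) (n i : nat) (z : A) : 'M[A]_n :=
  1%:M + z *: mxunit A n 1 (2 * i + 1) - (2 * z) *: mxunit A n (2 * i) 1
    - z ^+ 2 *: mxunit A n (2 * i) (2 * i + 1).

Definition F2 (A : comNzRingType) (n i : nat) (z : A) : 'M[A]_n :=
  1%:M + z *: mxunit A n 1 (2 * i) - (2 * z) *: mxunit A n (2 * i + 1) 1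
    - z ^+ 2 *: mxunit A n (2 * i + 1) (2 * i).

(* Indexed by the size n of the matrices; meaningful for n = 2r + 1, in which
   case n./2 = r. *)
Inductive in_EO (A : comUnitRingType) (n : nat) : 'M[A]_n -> Prop :=
  | EO_F1 i z : (1 <= i <= n./2)%N -> in_EO (F1 n i z)
  | EO_F2 i z : (1 <= i <= n./2)%N -> in_EO (F2 n i z)
  | EO_1 : in_EO 1%:M
  | EO_mul M N : in_EO M -> in_EO N -> in_EO (M *m N)
  | EO_inv M : in_EO M -> in_EO (invmx M).

Definition homotopic_to_id (R : comNzRingType) (n : nat) (M : 'M[R]_n) : Prop :=
  exists P : 'M[{poly R}]_n,
    [/\ in_SO P, map_mx (horner_eval 0) P = 1%:M & map_mx (horner_eval 1) P = M].

Definition commutator (R : comUnitRingType) (n : nat) (M N : 'M[R]_n) : 'M[R]_n :=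
  M *m N *m invmx M *m invmx N.

(* Main.v *)
From HB Require Import structures.
Require Import Defs.
From mathcomp Require Import boolp.
From mathcomp Require Import all_boot all_order all_algebra.
From mathcomp Require Import ring_quotient ring zify.

Set Implicit Arguments.
Unset Strict Implicit.
Unset Printing Implicit Defensive.
Import GRing.Theory.
Local Open Scope ring_scope.

(** Let V be the module of rank n = 2m - 1 with the form of the statement, and
    let H be the hyperbolic plane with basis e, f that is added to V.  For u
    isotropic and w orthogonal to u write E(u, w) for the Eichler transvection.
    The generators F^1_i(z) and F^2_i(z) are the transvections E(u, z x) with u
    running over the isotropic basis vectors and x the anisotropic one;
    conjugating them by each other gives every E(e, w) and E(f, w) with w in V
    ([in_EO_egroup]).  Let G be the group generated by the latter.  An isometry
    g of V, extended by the identity on H, satisfies g E(e, w) g^-1 = E(e, g w)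
    and the same for f, so G is visibly normalised by O(V).  It remains to show
    that [alpha, beta] is in G; three ideas do this.

    Reflections.  If v is in V and q(v) is a unit, an element of G moves v to
    e + q(v) f, which has the same norm.  Hence the reflection in v is conjugate
    under G to one in O(H), and O(H) commutes with O(V).  So a product b of such
    reflections can be written b = eps rho with eps in G and rho commuting with
    O(V) ([decomposable_refl]), and then [g, b] = (g eps g^-1) eps^-1 for g in
    O(V).

    Dilation.  Suppose that beta is a product of reflections only over R_s.  If
    g is congruent to 1 modulo a high power of s, then (g eps g^-1) eps^-1 is
    made of transvections E(e, g w - w) and E(f, g w - w), whose vectors are
    divisible by a high power of s, conjugated by transvections with
    denominators.  As V contains two orthogonal hyperbolic planes, such
    conjugates are again products of integral transvections divisible by s^M
    ([egroup_conj_opposite]).  Thus [g, beta] agrees over R_s with an element of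
    G defined over R, and both are congruent to 1 modulo s^M.  The s-torsion of
    the Noetherian ring R is killed by one power of s, so for M large the two
    agree over R ([commutator_near_one]).

    Patching.  Let alpha(X) be the given path.  Call s good if for some k a
    change of the parameter by a multiple of s^k changes [alpha(t), beta] only
    by elements of G.  Good elements form a radical ideal, by splitting such a
    change into a chain of smaller ones ([commutator_path]).  To see that 1 is
    good, run the proof of the Cartan-Dieudonne theorem: for x in an orthogonal
    basis with q(x) a unit, v = beta x - x and v' = beta x + x satisfy
    q(v) + q(v') = 4 q(x), so that q(v) and q(v') generate the unit ideal, and
    after inverting either of them one or two reflections make beta fix x.  At
    the leaves of this binary tree beta is a product of reflections over R_s, so
    s is good there; going back to the root, 1 is good ([reached_descent]).
    Hence moving the parameter from 0 to 1 shows that [alpha, beta] is in G. *)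

(** * Inverting one element *)
Section Localization.
Variables (R : comNzRingType) (s : R).

(** The localization R_s is taken as the quotient of R[X] by s X - 1, which makes
    its elements polynomials in the inverse of s. *)
Definition loc_poly : {poly R} := s%:P * 'X - 1.

Definition loc_ideal : pred {poly R} := fun p => `[< exists q, p = loc_poly * q >].

(** The coefficients of the quotient are forced to be - s^i c, and they vanish
    eventually; so constants in the ideal are s-torsion. *)
Lemma loc_poly_mul_const (q : {poly R}) (c : R) :
  c%:P = loc_poly * q -> exists k, s ^+ k * c = 0.
Proof.
move=> E.
have q0 : q`_0 = - c.
  move/polyP/(_ 0%N): E.
  rewrite coefC eqxx /loc_poly mulrBl mul1r -mulrA coefB coefCM coefXM /= mulr0.
  by move=> ->; rewrite sub0r opprK.
have qS i : q`_i.+1 = s * q`_i.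
  move/polyP/(_ i.+1): E.
  rewrite coefC /= /loc_poly mulrBl mul1r -mulrA coefB coefCM coefXM /=.
  by move/esym/eqP; rewrite subr_eq0 => /eqP ->.
have qE i : q`_i = - (s ^+ i * c).
  by elim: i => [|i IH]; rewrite ?q0 ?expr0 ?mul1r // qS IH exprS mulrN mulrA.
exists (size q); apply/eqP; rewrite -oppr_eq0 -qE.
by rewrite nth_default.
Qed.

Hypothesis snil : forall k, s ^+ k != 0.

Lemma loc_ideal_closed : idealr_closed loc_ideal.
Proof.
split.
- by apply/asboolP; exists 0; rewrite mulr0.
- apply/asboolPn => -[q /loc_poly_mul_const [k]].
  by move/eqP; rewrite mulr1 (negPf (snil k)).
- move=> a _ _ /asboolP[p ->] /asboolP[q ->]; apply/asboolP.
  by exists (a * p + q); rewrite mulrDr mulrCA.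
Qed.

(** These three properties characterise the localization R_s. *)
Lemma localization_exists :
  exists (S : comNzRingType) (i : {rmorphism R -> S}) (t : S),
    [/\ i s * t = 1,
        forall a, exists k r, i s ^+ k * a = i r
      & forall r, i r = 0 -> exists k, s ^+ k * r = 0].
Proof.
pose I : idealr {poly R} := HB.pack loc_ideal
  (isIdealr.Build {poly R} loc_ideal loc_ideal_closed).
pose S : comNzRingType := {ideal_quot I}.
pose p : {rmorphism {poly R} -> S} := \pi_S%qT.
pose i : {rmorphism R -> S} := p \o polyC.
have pK q : p (loc_poly * q) = 0.
  apply/eqP; rewrite -(rmorph0 p); rewrite -Quotient.idealrBE subr0.
  by apply/asboolP; exists q.
have it : i s * p 'X = 1.
  have := pK 1; rewrite mulr1 /loc_poly rmorphB rmorphM rmorph1.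
  by move/eqP; rewrite subr_eq0 => /eqP.
exists S, i, (p 'X); split=> //.
- move=> a; rewrite -[a]reprK -[\pi_S%qT _]/(p _); move: (repr a) => q {a}.
  elim/poly_ind: q => [|q c [k [r IH]]].
    by exists 0%N, 0; rewrite !rmorph0 mulr0.
  exists k.+1, (r + s ^+ k.+1 * c).
  rewrite (rmorphD p) (rmorphM p) mulrDr (rmorphD i) (rmorphM i) rmorphXn; congr (_ + _).
  by rewrite -IH exprSr mulrACA it mulr1.
- move=> r /eqP; rewrite -(rmorph0 p) -Quotient.idealrBE subr0.
  by move/asboolP => [q /loc_poly_mul_const].
Qed.

End Localization.

(** * Quadratic spaces, transvections and reflections *)
Lemma mx_ext (A : comNzRingType) (m n : nat) (M N : 'M[A]_(m, n)) :
  (forall x : 'cV_n, M *m x = N *m x) -> M = N.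
Proof. by move=> E; apply/trmx_inj/row_matrixP=> j; rewrite -!tr_col !colE E. Qed.

Section Transvections.
Variables (A : comNzRingType) (N : nat) (Phi : 'M[A]_N) (half : A).
Hypothesis PhiT : Phi^T = Phi.
Hypothesis half2 : 2 * half = 1.
Implicit Types (e f u v w x y z : 'cV[A]_N) (g h : 'M[A]_N).

Definition bil x y : A := (x^T *m Phi *m y) 0 0.

Lemma bilDl x y z : bil (x + y) z = bil x z + bil y z.
Proof. by rewrite /bil linearD /= !mulmxDl mxE. Qed.
Lemma bilDr x y z : bil x (y + z) = bil x y + bil x z.
Proof. by rewrite /bil !mulmxDr mxE. Qed.
Lemma bilNl x y : bil (- x) y = - bil x y.
Proof. by rewrite /bil linearN /= !mulNmx mxE. Qed.
Lemma bilNr x y : bil x (- y) = - bil x y.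
Proof. by rewrite /bil mulmxN mxE. Qed.
Lemma bilZl a x y : bil (a *: x) y = a * bil x y.
Proof. by rewrite /bil linearZ /= -!scalemxAl mxE. Qed.
Lemma bilZr a x y : bil x (a *: y) = a * bil x y.
Proof. by rewrite /bil -!scalemxAr mxE. Qed.
Lemma bil0l x : bil 0 x = 0.
Proof. by rewrite /bil trmx0 !mul0mx mxE. Qed.
Lemma bil0r x : bil x 0 = 0.
Proof. by rewrite /bil mulmx0 mxE. Qed.
Lemma bilC x y : bil x y = bil y x.
Proof.
rewrite /bil; have -> : x^T *m Phi *m y = (y^T *m Phi *m x)^T.
  by rewrite !trmx_mul PhiT trmxK mulmxA.
by rewrite mxE.
Qed.

Definition bilE := (bilDl, bilDr, bilNl, bilNr, bilZl, bilZr, bil0l, bil0r).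

Lemma mul_outer u v x : u *m (v^T *m Phi) *m x = bil v x *: u.
Proof. by rewrite -mulmxA [X in u *m X]mx11_scalar mul_mx_scalar. Qed.

(** The quadratic form with polar form [bil], so that q(x) = B(x, x) / 2. *)
Definition quad x : A := half * bil x x.

Lemma quad2 x : bil x x = 2 * quad x.
Proof. by rewrite mulrA half2 mul1r. Qed.

Lemma quadD x y : quad (x + y) = quad x + quad y + bil x y.
Proof.
rewrite /quad !bilE (bilC y x).
by transitivity (half * bil x x + half * bil y y + 2 * half * bil x y);
  [ring | rewrite half2 mul1r].
Qed.
Lemma quadZ a x : quad (a *: x) = a ^+ 2 * quad x.
Proof. by rewrite /quad !bilE; ring. Qed.
Lemma quadN x : quad (- x) = quad x.
Proof. by rewrite /quad !bilE; ring. Qed.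

Definition quadE := (quadD, quadZ, quadN).

(** The Eichler transvection E(u, w), which is an isometry when u is isotropic
    and w is orthogonal to u. *)
Definition eichler u w : 'M[A]_N :=
  1%:M + w *m (u^T *m Phi) - u *m (w^T *m Phi) - quad w *: (u *m (u^T *m Phi)).

Lemma eichlerE u w x :
  eichler u w *m x = x + bil u x *: w - bil w x *: u - (quad w * bil u x) *: u.
Proof.
by rewrite !mulmxBl mulmxDl mul1mx -scalemxAl !mul_outer scalerA.
Qed.

Definition isometric g := g^T *m Phi *m g = Phi.

Lemma bil_iso g x y : isometric g -> bil (g *m x) (g *m y) = bil x y.
Proof.
by move=> I; rewrite /bil trmx_mul -[in RHS]I !mulmxA.
Qed.

Lemma isometric_mul g h : isometric g -> isometric h -> isometric (g *m h).
Proof.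
rewrite /isometric => Ig Ih.
by rewrite trmx_mul -!mulmxA (mulmxA g^T) (mulmxA _ g) Ig mulmxA Ih.
Qed.

Lemma bil_isol g g' x y : isometric g -> g *m g' = 1%:M ->
  bil (g *m x) y = bil x (g' *m y).
Proof. by move=> I V; rewrite -[y in LHS]mul1mx -V -mulmxA bil_iso. Qed.

Lemma quad_iso g x : isometric g -> quad (g *m x) = quad x.
Proof. by move=> I; rewrite /quad bil_iso. Qed.

(** An isometry transports all the data that define a transvection.  This is the
    reason why the group of [egroup] below is normalised by isometries that fix
    e and f. *)
Lemma eichler_conj g g' u w : isometric g -> g *m g' = 1%:M ->
  g *m eichler u w *m g' = eichler (g *m u) (g *m w).
Proof.
move=> I V; apply: mx_ext => x.
rewrite -!mulmxA !eichlerE !(bil_isol _ _ I V) quad_iso //.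
by rewrite !mulmxBr mulmxDr -!scalemxAr mulmxA V mul1mx.
Qed.

Lemma eichler0 u : eichler u 0 = 1%:M.
Proof.
apply: mx_ext => x; rewrite eichlerE mul1mx /quad !bilE.
by apply/colP => i; rewrite !mxE; ring.
Qed.

Lemma eichler_add u w1 w2 : bil u u = 0 -> bil u w1 = 0 -> bil u w2 = 0 ->
  eichler u w1 *m eichler u w2 = eichler u (w1 + w2).
Proof.
move=> uu uw1 uw2; apply: mx_ext => x; rewrite -mulmxA !eichlerE !bilE !quadE.
rewrite (bilC w1 u) uu uw1 uw2.
by apply/colP => i; rewrite !mxE; ring.
Qed.

Lemma eichlerN u w : bil u u = 0 -> bil u w = 0 ->
  eichler u w *m eichler u (- w) = 1%:M.
Proof. by move=> uu uw; rewrite eichler_add ?bilNr ?uw ?oppr0 // subrr eichler0. Qed.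

Lemma eichlerNl u w : bil u u = 0 -> bil u w = 0 ->
  eichler u (- w) *m eichler u w = 1%:M.
Proof. by move=> uu uw; rewrite eichler_add ?bilNr ?uw ?oppr0 // addNr eichler0. Qed.

(** For two isotropic vectors the transvection is the exponential of their wedge
    product, which is antisymmetric. *)
Lemma eichler_swap u w : bil u u = 0 -> bil w w = 0 ->
  eichler u w = eichler w (- u).
Proof.
move=> uu ww; apply: mx_ext => x; rewrite !eichlerE !quadE !bilE /quad uu ww.
by apply/colP => i; rewrite !mxE; ring.
Qed.

Lemma eichler_scale a u w : eichler (a *: u) w = eichler u (a *: w).
Proof.
apply: mx_ext => x; rewrite !eichlerE !quadE !bilE.
by apply/colP => i; rewrite !mxE; ring.
Qed.

Lemma bil_sep (M M' : 'M[A]_N) :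
  (forall x y : 'cV_N, (x^T *m M *m y) 0 0 = (x^T *m M' *m y) 0 0) -> M = M'.
Proof.
move=> E; apply/matrixP => i j; have := E (delta_mx i 0) (delta_mx j 0).
by rewrite !trmx_delta -!rowE -!colE !mxE.
Qed.

Lemma isometricP g : (forall x y, bil (g *m x) (g *m y) = bil x y) -> isometric g.
Proof. by move=> I; apply: bil_sep => x y; rewrite -[RHS]I /bil trmx_mul !mulmxA. Qed.

Lemma eichler_isometric u w : bil u u = 0 -> bil u w = 0 -> isometric (eichler u w).
Proof.
move=> uu uw; apply: isometricP => x y; rewrite !eichlerE !bilE.
rewrite !(bilC x) !(bilC w u) uu uw quad2; ring.
Qed.

(** With c inverse to q(v) this is the reflection in v.  The inverse is an
    argument because the base ring comes without an inversion. *)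
Definition refl (c : A) v : 'M[A]_N := 1%:M - c *: (v *m (v^T *m Phi)).

Lemma reflE c v x : refl c v *m x = x - (c * bil v x) *: v.
Proof. by rewrite mulmxBl mul1mx -scalemxAl mul_outer scalerA. Qed.

Lemma refl_conj g g' c v : isometric g -> g *m g' = 1%:M ->
  g *m refl c v *m g' = refl c (g *m v).
Proof.
move=> I V; apply: mx_ext => x.
rewrite -!mulmxA !reflE !(bil_isol _ _ I V).
by rewrite !mulmxBr -!scalemxAr mulmxA V mul1mx.
Qed.

Lemma refl_invol c v : c * quad v = 1 -> refl c v *m refl c v = 1%:M.
Proof.
move=> cv; apply: mx_ext => x; rewrite -mulmxA !reflE !bilE quad2 mul1mx.
apply/colP => i; rewrite !mxE.
transitivity (x i 0 + 2 * (c * quad v - 1) * c * bil v x * v i 0); first by ring.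
by rewrite cv; ring.
Qed.

Lemma refl_isometric c v : c * quad v = 1 -> isometric (refl c v).
Proof.
move=> cv; apply: isometricP => x y; rewrite !reflE !bilE quad2 (bilC x v).
transitivity (bil x y + 2 * (c * quad v - 1) * c * bil v x * bil v y); first by ring.
by rewrite cv; ring.
Qed.

(** * The group generated by transvections along a hyperbolic plane *)
Definition hypPair e f := [/\ bil e e = 0, bil f f = 0 & bil e f = 1].

Definition orthTo e f x := bil e x = 0 /\ bil f x = 0.

(** The condition [K] on the vectors selects all of V, or the vectors of V that
    are integral and divisible by a power of s.  Inverses need not be generators:
    [K] will be stable under opposites. *)
Inductive egroup (e f : 'cV[A]_N) (K : 'cV[A]_N -> Prop) : 'M[A]_N -> Prop :=
  | egroup1 : egroup e f K 1%:M
  | egroup_e w g : K w -> egroup e f K g -> egroup e f K (eichler e w *m g)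
  | egroup_f w g : K w -> egroup e f K g -> egroup e f K (eichler f w *m g).

Implicit Types (K : 'cV[A]_N -> Prop).

Lemma egroup_swap e f K g : egroup e f K g -> egroup f e K g.
Proof.
by elim=> [|w h Kw _ IH|w h Kw _ IH]; [apply: egroup1|apply: egroup_f|apply: egroup_e].
Qed.

Lemma egroup_mono e f K K' g : (forall w, K w -> K' w) ->
  egroup e f K g -> egroup e f K' g.
Proof.
by move=> sub; elim=> [|w h /sub Kw _ IH|w h /sub Kw _ IH];
  [apply: egroup1|apply: egroup_e|apply: egroup_f].
Qed.

Lemma egroup_mul e f K g h : egroup e f K g -> egroup e f K h -> egroup e f K (g *m h).
Proof.
move=> Gg Gh; elim: Gg => [|w k Kw _ IH|w k Kw _ IH]; first by rewrite mul1mx.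
  by rewrite -mulmxA; apply: egroup_e.
by rewrite -mulmxA; apply: egroup_f.
Qed.

Lemma egroup_eichler_e e f K w : K w -> egroup e f K (eichler e w).
Proof. by move=> Kw; rewrite -[eichler _ _]mulmx1; apply: egroup_e => //; apply: egroup1. Qed.

Lemma egroup_eichler_f e f K w : K w -> egroup e f K (eichler f w).
Proof. by move=> Kw; rewrite -[eichler _ _]mulmx1; apply: egroup_f => //; apply: egroup1. Qed.

Lemma egroup_conj e f K K' h h' g : h *m h' = 1%:M -> h' *m h = 1%:M ->
  (forall w, K w -> egroup e f K' (h *m eichler e w *m h')) ->
  (forall w, K w -> egroup e f K' (h *m eichler f w *m h')) ->
  egroup e f K g -> egroup e f K' (h *m g *m h').
Proof.
move=> V V' He Hf; elim=> [|w k Kw _ IH|w k Kw _ IH].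
- by rewrite mulmx1 V; apply: egroup1.
- have -> : h *m (eichler e w *m k) *m h' = (h *m eichler e w *m h') *m (h *m k *m h').
    by rewrite !mulmxA -(mulmxA _ h' h) V' mulmx1.
  by apply: egroup_mul => //; apply: He.
- have -> : h *m (eichler f w *m k) *m h' = (h *m eichler f w *m h') *m (h *m k *m h').
    by rewrite !mulmxA -(mulmxA _ h' h) V' mulmx1.
  by apply: egroup_mul => //; apply: Hf.
Qed.

Lemma egroup_inv e f K g : hypPair e f ->
  (forall w, K w -> orthTo e f w) -> (forall w, K w -> K (- w)) ->
  egroup e f K g -> exists2 h, egroup e f K h & g *m h = 1%:M /\ h *m g = 1%:M.
Proof.
move=> [ee ff _] KV KN; elim=> [|w k Kw _ [h Gh [V V']]|w k Kw _ [h Gh [V V']]].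
- by exists 1%:M; [apply: egroup1 | rewrite mulmx1].
- have [ew fw] := KV w Kw.
  exists (h *m eichler e (- w)).
    by apply: egroup_mul => //; apply: egroup_eichler_e; apply: KN.
  split; first by rewrite mulmxA -(mulmxA _ k) V mulmx1 eichlerN.
  by rewrite mulmxA -(mulmxA h) eichlerNl // mulmx1.
- have [ew fw] := KV w Kw.
  exists (h *m eichler f (- w)).
    by apply: egroup_mul => //; apply: egroup_eichler_f; apply: KN.
  split; first by rewrite mulmxA -(mulmxA _ k) V mulmx1 eichlerN.
  by rewrite mulmxA -(mulmxA h) eichlerNl // mulmx1.
Qed.

(** The pairs of an isometry and its inverse that come from O(V). *)
Definition fixes e f g g' :=
  [/\ isometric g, g *m g' = 1%:M, g' *m g = 1%:M, g *m e = e & g *m f = f].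

Lemma hypPair_swap e f : hypPair e f -> hypPair f e.
Proof. by move=> [ee ff ef]; split=> //; rewrite bilC. Qed.

Lemma egroup_inverse e f g : hypPair e f -> egroup e f (orthTo e f) g ->
  exists2 h, egroup e f (orthTo e f) h & g *m h = 1%:M /\ h *m g = 1%:M.
Proof.
by move=> ef; apply: egroup_inv => // v [ev fv]; split; rewrite bilNr ?ev ?fv oppr0.
Qed.

(** The matrix [rho] stands for an isometry of the plane of e and f; what matters
    of it is that it commutes with O(V) and normalises the group of
    transvections. *)
Definition decomposable e f b := exists eps rho rho',
  [/\ b = eps *m rho, egroup e f (orthTo e f) eps,
      rho *m rho' = 1%:M /\ rho' *m rho = 1%:M,
      forall g g', fixes e f g g' -> g *m rho = rho *m g
    & forall h, egroup e f (orthTo e f) h -> egroup e f (orthTo e f) (rho *m h *m rho')].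

Lemma decomposable1 e f : decomposable e f 1%:M.
Proof.
exists 1%:M, 1%:M, 1%:M; split; rewrite ?mulmx1 //; first exact: egroup1.
  by move=> g g' _; rewrite mulmx1 mul1mx.
by move=> h; rewrite mulmx1 mul1mx.
Qed.

Lemma decomposable_mul e f b1 b2 :
  decomposable e f b1 -> decomposable e f b2 -> decomposable e f (b1 *m b2).
Proof.
move=> [eps1 [rho1 [rho1' [-> G1 [V1 V1'] C1 J1]]]].
move=> [eps2 [rho2 [rho2' [-> G2 [V2 V2'] C2 J2]]]].
exists (eps1 *m (rho1 *m eps2 *m rho1')), (rho1 *m rho2), (rho2' *m rho1'); split.
- by rewrite !mulmxA -(mulmxA _ rho1' rho1) V1' mulmx1.
- by apply: egroup_mul => //; apply: J1.
- split; first by rewrite mulmxA -(mulmxA rho1) V2 mulmx1.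
  by rewrite mulmxA -(mulmxA rho2') V1' mulmx1.
- by move=> g g' F; rewrite mulmxA (C1 _ _ F) -mulmxA (C2 _ _ F) mulmxA.
- move=> h Gh; have -> : rho1 *m rho2 *m h *m (rho2' *m rho1') =
      rho1 *m (rho2 *m h *m rho2') *m rho1' by rewrite !mulmxA.
  by apply: J1; apply: J2.
Qed.

(** The vectors v and x = e + q(v) f have the same norm, and two transvections
    move v to x: one first adds e to v, and the second removes v.  So the
    reflections in v and in x are conjugate, and the latter exchanges the lines
    of e and f. *)
Lemma decomposable_refl e f c v : hypPair e f -> orthTo e f v -> c * quad v = 1 ->
  decomposable e f (refl c v).
Proof.
move=> ef Ov cv; have [[ee ff e1] [ev fv]] := (ef, Ov).
have fe : bil f e = 1 by rewrite bilC.
have ve : bil v e = 0 by rewrite bilC.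
have vf : bil v f = 0 by rewrite bilC.
have [q qE] : exists q, q = quad v by eexists.
have [x xE] : exists x, x = e + q *: f by eexists.
have qx : quad x = q.
  by rewrite xE !quadE bilZr e1 /quad ee ff; ring.
have cx : c * quad x = 1 by rewrite qx qE.
have xw w : orthTo e f w -> bil x w = 0.
  by move=> [ew fw]; rewrite xE !bilE ew fw mulr0 addr0.
pose rho := refl c x.
have rr : rho *m rho = 1%:M by apply: refl_invol.
have Irho : isometric rho by apply: refl_isometric.
have cq : c * q = 1 by rewrite qE.
have re : rho *m e = - q *: f.
  have xe : bil x e = q by rewrite xE !bilE ee fe; ring.
  by apply/colP => i; rewrite reflE xe cq xE !mxE; ring.
have rf : rho *m f = - c *: e.
  have xf : bil x f = 1 by rewrite xE !bilE ff e1; ring.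
  apply/colP => i; rewrite reflE xf xE !mxE.
  by transitivity (f i 0 - (c * q) * f i 0 - c * e i 0); [ring | rewrite cq; ring].
have rw w : orthTo e f w -> rho *m w = w.
  by move=> Ow; rewrite reflE xw // mulr0 scale0r subr0.
have OZ a w : orthTo e f w -> orthTo e f (a *: w).
  by move=> [ew fw]; split; rewrite bilZr ?ew ?fw mulr0.
have J h : egroup e f (orthTo e f) h -> egroup e f (orthTo e f) (rho *m h *m rho).
  apply: egroup_conj => // w Ow; rewrite eichler_conj // (rw w Ow) ?re ?rf eichler_scale.
    by apply: egroup_eichler_f; apply: OZ.
  by apply: egroup_eichler_e; apply: OZ.
(* E(e, - w1) maps v to v + B(v, w1) e = v + e, because c is inverse to q(v). *)
pose w1 := (c * half) *: v.
have Ow1 : orthTo e f w1 by apply: OZ.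
have [ew1 fw1] := Ow1.
pose eps1 := eichler f (- v) *m eichler e (- w1).
pose eps2 := eichler e w1 *m eichler f v.
have V12 : eps1 *m eps2 = 1%:M.
  by rewrite /eps1 /eps2 mulmxA -(mulmxA (eichler f _)) eichlerNl // mulmx1 eichlerNl.
have V21 : eps2 *m eps1 = 1%:M.
  by rewrite /eps1 /eps2 mulmxA -(mulmxA (eichler e _)) eichlerN // mulmx1 eichlerN.
have ON w : orthTo e f w -> orthTo e f (- w) by rewrite -scaleN1r; apply: OZ.
have G1 : egroup e f (orthTo e f) eps1.
  by apply: egroup_mul; [apply: egroup_eichler_f|apply: egroup_eichler_e]; apply: ON.
have G2 : egroup e f (orthTo e f) eps2.
  by apply: egroup_mul; [apply: egroup_eichler_e|apply: egroup_eichler_f].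
have eps1v : eps1 *m v = x.
  have E1 : eichler e (- w1) *m v = v + e.
    rewrite eichlerE ev /w1 bilNl bilZl quad2 -qE.
    have -> : c * half * (2 * q) = 1.
      by transitivity (c * q * (2 * half)); [ring | rewrite cq half2 mulr1].
    by apply/colP => i; rewrite !mxE; ring.
  rewrite -mulmxA E1 eichlerE !bilE quadN fv fe ve quad2 -qE xE.
  by apply/colP => i; rewrite !mxE; ring.
have Ieps1 : isometric eps1.
  by apply: isometric_mul; apply: eichler_isometric; rewrite ?bilNr ?fv ?ew1 ?oppr0.
clearbody eps1 eps2.
exists (eps2 *m (rho *m eps1 *m rho)), rho, rho; split=> //.
- have E : eps1 *m refl c v *m eps2 = rho by rewrite refl_conj // eps1v.
  rewrite !mulmxA -(mulmxA _ rho rho) rr mulmx1 -[in RHS]E !mulmxA V21 mul1mx.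
  by rewrite -mulmxA V21 mulmx1.
- by apply: egroup_mul => //; apply: J.
- move=> g g' [I gg' g'g ge gf].
  have gx : g *m x = x by rewrite xE mulmxDr -scalemxAr ge gf.
  by rewrite -[LHS]mulmx1 -g'g mulmxA refl_conj // gx.
Qed.

(** * Conjugation by transvections with denominators *)
Section Dilation.
(** [Int] is a subring, the image of the base ring, of which the ambient ring is
    the localization at s.  Working with a subring avoids carrying a morphism
    through the computations. *)
Variables (Int : A -> Prop) (s : A).
Hypothesis Int1 : Int 1.
Hypothesis IntB : forall a b, Int a -> Int b -> Int (a - b).
Hypothesis IntM : forall a b, Int a -> Int b -> Int (a * b).
Hypothesis Int_half : Int half.
Hypothesis Int_s : Int s.
Hypothesis Int_Phi : forall i j, Int (Phi i j).
Hypothesis Int_frac : forall a, exists k, Int (s ^+ k * a).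
Hypothesis s_unit : exists t, s * t = 1.

Lemma Int0 : Int 0.
Proof. by rewrite -(subrr 1); apply: IntB. Qed.
Lemma IntN a : Int a -> Int (- a).
Proof. by move=> Ia; rewrite -[- a]add0r; apply: IntB => //; apply: Int0. Qed.
Lemma IntD a b : Int a -> Int b -> Int (a + b).
Proof. by move=> Ia Ib; rewrite -[b]opprK; apply: IntB => //; apply: IntN. Qed.
Lemma IntX k : Int (s ^+ k).
Proof. by elim: k => [|k IH]; rewrite ?expr0 // exprS; apply: IntM. Qed.
Lemma Int_sum (I : finType) (F : I -> A) : (forall i, Int (F i)) -> Int (\sum_i F i).
Proof. by move=> IF; apply: big_ind => //; [apply: Int0 | apply: IntD]. Qed.
Lemma Int_frac_ge a : exists k, forall j, (k <= j)%N -> Int (s ^+ j * a).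
Proof.
have [k Ik] := Int_frac a; exists k => j kj.
by rewrite -(subnK kj) exprD -mulrA; apply: IntM => //; apply: IntX.
Qed.

Definition IntV w := forall i, Int (w i 0).

Lemma IntVD w x : IntV w -> IntV x -> IntV (w + x).
Proof. by move=> Iw Ix i; rewrite mxE; apply: IntD. Qed.
Lemma IntVZ a w : Int a -> IntV w -> IntV (a *: w).
Proof. by move=> Ia Iw i; rewrite mxE; apply: IntM. Qed.
Lemma IntVN w : IntV w -> IntV (- w).
Proof. by move=> Iw i; rewrite mxE; apply: IntN. Qed.
Lemma Int_bil x y : IntV x -> IntV y -> Int (bil x y).
Proof.
move=> Ix Iy; rewrite /bil mxE; apply: Int_sum => i.
apply: IntM => //; rewrite mxE; apply: Int_sum => j.
by rewrite mxE; apply: IntM.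
Qed.
Lemma Int_quad x : IntV x -> Int (quad x).
Proof. by move=> Ix; apply: IntM => //; apply: Int_bil. Qed.

Lemma IntV_frac w : exists k, IntV (s ^+ k *: w).
Proof.
have [k Hk] := fin_all_exists (fun i => Int_frac_ge (w i 0)).
exists (\max_i k i)%N => i; rewrite mxE; apply: Hk; exact: leq_bigmax.
Qed.

Lemma s_cancel k a : s ^+ k * a = 0 -> a = 0.
Proof.
have [t st] := s_unit; elim: k a => [|k IH] a; first by rewrite mul1r.
rewrite exprS -mulrA => E; apply: IH.
by rewrite -[_ * a]mul1r -st [s * t]mulrC -mulrA E mulr0.
Qed.

Definition deep e f M w :=
  orthTo e f w /\ exists2 w0, IntV w0 & w = s ^+ M *: w0.

Lemma deep_swap e f M w : deep e f M w -> deep f e M w.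
Proof. by case=> -[? ?] ?. Qed.

Lemma deep_scale e f M j w0 : orthTo e f w0 -> IntV w0 -> (M <= j)%N ->
  deep e f M (s ^+ j *: w0).
Proof.
move=> [ew fw] Iw Mj; split; first by split; rewrite bilZr ?ew ?fw mulr0.
exists (s ^+ (j - M) *: w0); first by apply: IntVZ => //; apply: IntX.
by rewrite scalerA -exprD subnKC.
Qed.

Lemma deep_orth e f M w0 : orthTo e f (s ^+ M *: w0) -> orthTo e f w0.
Proof. by case; rewrite !bilZr => /s_cancel ? /s_cancel. Qed.

Lemma deep_le e f M M' w : (M <= M')%N -> deep e f M' w -> deep e f M w.
Proof.
move=> MM [O [w0 Iw E]]; rewrite E; apply: deep_scale => //.
by apply: (@deep_orth _ _ M'); rewrite -E.
Qed.

Lemma deepZ e f M a w : Int a -> deep e f M w -> deep e f M (a *: w).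
Proof.
move=> Ia [[ew fw] [w0 Iw E]]; split; first by split; rewrite bilZr ?ew ?fw mulr0.
by exists (a *: w0); [apply: IntVZ | rewrite E !scalerA mulrC].
Qed.

(** E(f, x) moves e to e + x - q(x) f and fixes y; since y is isotropic,
    E(u, a y) = E(y, - a u) is additive in u, and the three factors are its values
    at the three terms. *)
Lemma eichler_conj_isotropic e f x y a : hypPair e f -> orthTo e f x ->
  orthTo e f y -> bil y y = 0 -> bil x y = 0 ->
  eichler f x *m eichler e (a *: y) *m eichler f (- x) =
  eichler e (a *: y) *m eichler y (- a *: x) *m eichler f (- (a * quad x) *: y).
Proof.
move=> [ee ff ef] [ex fx] [ey fy] yy xy.
rewrite (eichler_conj _ _ (eichler_isometric ff fx)) ?eichlerN //.
apply: mx_ext => v; rewrite -!mulmxA !eichlerE !(bilE, quadE).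
rewrite /quad ?(bilC f e) ?(bilC x e) ?(bilC x f) ?(bilC y e) ?(bilC y f) ?(bilC y x).
rewrite ?ee ?ff ?ef ?ex ?fx ?ey ?fy ?yy ?xy.
by apply/colP => i; rewrite !mxE; ring.
Qed.

(** Solving the previous formula for its middle factor: a transvection inside V
    is, up to transvections along e and f, a commutator of such.  Splitting the
    factor s^(2M) evenly between the two keeps both of them divisible by s^M. *)
Lemma egroup_eichler_isotropic e f M x y : hypPair e f -> orthTo e f x ->
  orthTo e f y -> bil y y = 0 -> bil x y = 0 -> IntV x -> IntV y ->
  egroup e f (deep e f M) (eichler y (s ^+ (2 * M) *: x)).
Proof.
move=> ef [ex fx] [ey fy] yy xy Ix Iy.
pose p := - (s ^+ M) *: x.
have Op : orthTo e f p by rewrite /p; split; rewrite !bilE ?ex ?fx mulr0.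
have py : bil p y = 0 by rewrite !bilE xy mulr0.
have [ee ff _] := ef; have [ep fp] := Op.
have := eichler_conj_isotropic (s ^+ M) ef Op (conj ey fy) yy py.
set h := eichler f p; set h' := eichler f (- p); set T1 := eichler e _.
set T2 := eichler y _; set T3 := eichler f _ => E.
have dp : deep e f M p.
  rewrite /p scaleNr -scalerN; apply: deep_scale => //; last exact: IntVN.
  by split; rewrite bilNr ?ex ?fx oppr0.
have dN w : deep e f M w -> deep e f M (- w).
  by move=> dw; rewrite -scaleN1r; apply: deepZ => //; apply: IntN.
have dy : deep e f M (s ^+ M *: y) by apply: deep_scale.
have ey' : bil e (s ^+ M *: y) = 0 by rewrite bilZr ey mulr0.
have dq : deep e f M (- (s ^+ M * quad p) *: y).
  have -> : - (s ^+ M * quad p) *: y = - quad p *: (s ^+ M *: y).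
    by rewrite scalerA; congr (_ *: _); ring.
  apply: deepZ => //.
  apply/IntN/Int_quad/IntVZ => //; apply/IntN/IntX.
have fq : bil f (- (s ^+ M * quad p) *: y) = 0 by case: dq => -[].
have -> : s ^+ (2 * M) *: x = - s ^+ M *: p.
  by rewrite /p scalerA mulrNN -exprD addnn mul2n.
have -> : eichler y (- s ^+ M *: p) =
    eichler e (- (s ^+ M *: y)) *m (h *m T1 *m h') *m eichler f (- (- (s ^+ M * quad p) *: y)).
  by rewrite E mulmxA mulmxA eichlerNl // mul1mx -mulmxA eichlerN // mulmx1.
do !apply: egroup_mul.
- by apply: egroup_eichler_e; apply: dN.
- exact: egroup_eichler_f.
- exact: egroup_eichler_e.
- by apply: egroup_eichler_f; apply: dN.
- by apply: egroup_eichler_f; apply: dN.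
Qed.

(** The case of the dilation where no opposite roots meet, since y is isotropic
    and orthogonal to x: then [eichler_conj_isotropic] is an explicit answer,
    in which s^j has to absorb the denominators of x and of q(x). *)
Lemma egroup_conj_isotropic e f M x y : hypPair e f -> orthTo e f x ->
  orthTo e f y -> bil y y = 0 -> bil x y = 0 -> IntV y ->
  exists N0, forall j a, (N0 <= j)%N -> Int a ->
    egroup e f (deep e f M)
      (eichler f x *m eichler e ((s ^+ j * a) *: y) *m eichler f (- x)).
Proof.
move=> ef Ox Oy yy xy Iy; have [k Ik] := IntV_frac x.
exists (2 * M + 2 * k)%N => j a Mj Ia.
have [[ex fx] [ey fy]] := (Ox, Oy).
rewrite eichler_conj_isotropic //; apply: egroup_mul; first apply: egroup_mul.
- apply: egroup_eichler_e; rewrite -scalerA; apply: deep_scale; last by lia.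
    by split; rewrite bilZr ?ey ?fy mulr0.
  exact: IntVZ.
- have -> : - (s ^+ j * a) *: x =
      s ^+ (2 * M) *: (- (s ^+ (j - 2 * M - k) * a) *: (s ^+ k *: x)).
    rewrite !scalerA; congr (_ *: _); set b := (j - 2 * M - k)%N.
    have {1}-> : j = (2 * M + b + k)%N by rewrite /b; lia.
    rewrite !exprD; ring.
  apply: egroup_eichler_isotropic => //.
  + by split; rewrite !bilZr ?ex ?fx !mulr0.
  + by rewrite !bilZl xy !mulr0.
  + by apply: IntVZ => //; apply/IntN/IntM => //; apply: IntX.
- apply: egroup_eichler_f.
  have -> : - (s ^+ j * a * quad x) *: y =
      s ^+ (j - 2 * k) *: (- (a * quad (s ^+ k *: x)) *: y).
    rewrite scalerA quadZ; congr (_ *: _); have {1}-> : j = (j - 2 * k + 2 * k)%N by lia.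
    by rewrite exprD mulnC exprM; ring.
  apply: deep_scale; [|apply: IntVZ => //|by lia].
    by split; rewrite bilZr ?ey ?fy mulr0.
  by apply/IntN/IntM => //; apply: Int_quad.
Qed.

(** E(z, p) maps y to y + p - q(p) z, so conjugating E(e, a y) by it creates the
    vector a p.  All the remaining transvections are along z, or along e with
    vectors proportional to y and z: for x orthogonal to y and z, none of them is
    opposite to a transvection E(f, x), while E(e, a p) may be. *)
Lemma eichler_isotropic_split z y p e a : hypPair y z -> orthTo y z p ->
  orthTo y z e -> bil e e = 0 -> bil e p = 0 ->
  eichler e (a *: p) =
  eichler z p *m eichler e (a *: y) *m eichler z (- p) *m eichler e (- a *: y)
    *m eichler e ((a * quad p) *: z).
Proof.
move=> [yy zz yz] [yp zp] [ye ze] ee ep.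
have ey : bil e y = 0 by rewrite bilC.
have ez : bil e z = 0 by rewrite bilC.
rewrite (eichler_conj _ _ (eichler_isometric zz zp)) ?eichlerN //.
have -> : eichler z p *m e = e.
  by apply/colP => i; rewrite eichlerE ze bilC ep !mxE; ring.
have -> : eichler z p *m (a *: y) = a *: (y + p - quad p *: z).
  rewrite eichlerE !bilE (bilC z y) yz (bilC p y) yp.
  by apply/colP => i; rewrite !mxE; ring.
have E1 : bil e (y + p - quad p *: z) = 0 by rewrite !bilE ey ep ez mulr0 subr0 addr0.
rewrite -mulmxA !eichler_add ?bilE ?E1 ?ey ?ep ?ez ?mulr0 ?oppr0 ?addr0 //.
by congr eichler; apply/colP => i; rewrite !mxE; ring.
by rewrite mulr0.
Qed.

Lemma conj_mul h h' g1 g2 : h' *m h = 1%:M ->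
  h *m (g1 *m g2) *m h' = (h *m g1 *m h') *m (h *m g2 *m h').
Proof. by move=> V; rewrite !mulmxA -(mulmxA _ h' h) V mulmx1. Qed.

(** The opposite transvections E(f, x) and E(e, w), in the case where some
    hyperbolic plane of V is orthogonal to x: the part of w in this plane is
    covered by [egroup_conj_isotropic], and the part orthogonal to it is first
    rewritten by [eichler_isotropic_split]. *)
Lemma egroup_conj_orth_plane e f M x y z : hypPair e f -> hypPair y z ->
  orthTo e f x -> orthTo e f y -> orthTo e f z -> orthTo y z x ->
  IntV y -> IntV z ->
  exists N0, forall j w, (N0 <= j)%N -> deep e f j w ->
    egroup e f (deep e f M) (eichler f x *m eichler e w *m eichler f (- x)).
Proof.
move=> ef yz Ox Oy Oz Oyx Iy Iz.
have [[ee ff e1] [yy zz y1]] := (ef, yz).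
have [[ex fx] [ey fy]] := (Ox, Oy).
have [[ez fz] [yx zx]] := (Oz, Oyx).
have xy : bil x y = 0 by rewrite bilC.
have xz : bil x z = 0 by rewrite bilC.
have [Ny Hy] := egroup_conj_isotropic M ef Ox Oy yy xy Iy.
have [Nz Hz] := egroup_conj_isotropic M ef Ox Oz zz xz Iz.
have [k Ik] := IntV_frac x.
pose L := (2 * M + k + Ny + Nz)%N.
exists (2 * L)%N => j w Lj [Ow [w0 Iw0 Ew]].
have Ow0 : orthTo e f w0 by apply: (@deep_orth _ _ j); rewrite -Ew.
pose b := bil z w0; pose c := bil y w0.
have Ib : Int b by apply: Int_bil.
have Ic : Int c by apply: Int_bil.
(* the component of w0 orthogonal to the plane of y and z *)
pose p0 := w0 - b *: y - c *: z.
have Ip0 : IntV p0.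
  by do 2![apply: IntVD; last by apply/IntVN/IntVZ].
have [ew0 fw0] := Ow0.
have Op0 : orthTo e f p0 by split; rewrite !bilE ?ew0 ?fw0 ?ey ?fy ?ez ?fz; ring.
have Oyp0 : orthTo y z p0.
  by split; rewrite !bilE ?(bilC z y) ?y1 ?yy ?zz -/b -/c; ring.
(* The exponent j is shared between the transvections along z and along e. *)
have [p pE] : exists p, p = s ^+ (j - L) *: p0 by exists (s ^+ (j - L) *: p0).
pose a := s ^+ L.
have Ew' : w = a *: p + (s ^+ j * b) *: y + (s ^+ j * c) *: z.
  rewrite Ew pE /a scalerA -exprD subnKC; last by lia.
  by apply/colP => i; rewrite !mxE; ring.
have [[ep0 fp0] [yp0 zp0]] := (Op0, Oyp0).
have Op : orthTo e f p by split; rewrite pE bilZr ?ep0 ?fp0 mulr0.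
have Oyp : orthTo y z p by split; rewrite pE bilZr ?yp0 ?zp0 mulr0.
have [[ep fp] [yp zp]] := (Op, Oyp).
have V' : eichler f (- x) *m eichler f x = 1%:M by rewrite eichlerNl.
have -> : eichler e w = eichler e (a *: p) *m eichler e ((s ^+ j * b) *: y)
    *m eichler e ((s ^+ j * c) *: z).
  by rewrite Ew' -!eichler_add // ?bilE ?ep ?ey ?ez ?mulr0 ?addr0.
rewrite !(conj_mul _ _ V').
apply: egroup_mul; last by apply: Hz => //; lia.
apply: egroup_mul; last by apply: Hy => //; lia.
have Oye : orthTo y z e by split; rewrite bilC.
rewrite (eichler_isotropic_split a yz Oyp Oye ee ep) !(conj_mul _ _ V').
(* E(f, x) fixes z and moves q by a multiple of f, and E(z, .) turns the latter
   into a transvection along f. *)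
have main q0 : IntV q0 -> orthTo e f q0 -> orthTo y z q0 ->
    egroup e f (deep e f M)
      (eichler f x *m eichler z (s ^+ (j - L) *: q0) *m eichler f (- x)).
  move=> Iq0 [eq0 fq0] [yq0 zq0]; set q := _ *: q0.
  have zq : bil z q = 0 by rewrite bilZr zq0 mulr0.
  rewrite (eichler_conj _ _ (eichler_isometric ff fx)) ?eichlerN //.
  have -> : eichler f x *m z = z.
    by apply/colP => i; rewrite eichlerE fz xz !mxE; ring.
  have -> : eichler f x *m q = q + (- bil x q) *: f.
    by rewrite eichlerE /q !bilE fq0; apply/colP => i; rewrite !mxE; ring.
  have zf : bil z f = 0 by rewrite bilC.
  rewrite -eichler_add ?zq // ?(bilZr _ _ f) ?zf ?mulr0 //.
  apply: egroup_mul.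
    have -> : q = s ^+ (2 * M) *: (s ^+ (j - L - 2 * M) *: q0).
      by rewrite scalerA -exprD subnKC //; lia.
    apply: egroup_eichler_isotropic => //.
    - by split; rewrite bilZr ?eq0 ?fq0 mulr0.
    - by rewrite bilZl (bilC q0) zq0 mulr0.
    - by apply: IntVZ => //; apply: IntX.
  rewrite scaleNr -scalerN -eichler_scale -eichler_swap //; last by rewrite bilZl bilZr zz !mulr0.
  apply: egroup_eichler_f.
  have -> : bil x q *: z = s ^+ (j - L - k) *: (bil (s ^+ k *: x) q0 *: z).
    rewrite /q !bilE scalerA; congr (_ *: _); set i := (j - L - k)%N.
    have -> : (j - L = i + k)%N by rewrite /i; lia.
    by rewrite exprD; ring.
  apply: deep_scale; last by lia.
    by split; rewrite bilZr ?ez ?fz mulr0.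
  by apply: IntVZ => //; apply: Int_bil.
apply: egroup_mul;
  [apply: egroup_mul; [apply: egroup_mul; [apply: egroup_mul|]|]|].
- by rewrite pE; apply: main.
- by rewrite -[a]mulr1; apply: Hy => //; rewrite /L; lia.
- rewrite pE -scalerN; apply: main; [exact: IntVN|split|split];
    by rewrite bilNr ?ep0 ?fp0 ?yp0 ?zp0 oppr0.
- by rewrite -[a]mulr1 -mulrN; apply: Hy; [rewrite /L; lia | exact: IntN].
- rewrite pE quadZ mulrA -exprM -exprD; apply: Hz; [rewrite /L; lia | exact: Int_quad].
Qed.

(** Any x in V is the sum of a vector in the first plane, orthogonal to the
    second plane, and of a vector orthogonal to the first plane.  So two planes
    suffice to reduce to [egroup_conj_orth_plane]. *)
Lemma egroup_conj_opposite e f M x y1 z1 y2 z2 : hypPair e f ->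
  hypPair y1 z1 -> hypPair y2 z2 ->
  orthTo e f y1 -> orthTo e f z1 -> orthTo e f y2 -> orthTo e f z2 ->
  orthTo y1 z1 y2 -> orthTo y1 z1 z2 ->
  IntV y1 -> IntV z1 -> IntV y2 -> IntV z2 -> orthTo e f x ->
  exists N0, forall j w, (N0 <= j)%N -> deep e f j w ->
    egroup e f (deep e f M) (eichler f x *m eichler e w *m eichler f (- x)).
Proof.
move=> ef yz1 yz2 Oy1 Oz1 Oy2 Oz2 O12 O12' Iy1 Iz1 Iy2 Iz2 Ox.
have [x1 x1E] : exists x1, x1 = bil z1 x *: y1 + bil y1 x *: z1 by eexists.
have [x2 x2E] : exists x2, x2 = x - x1 by eexists.
have [[ee ff e1] [yy zz yz]] := (ef, yz1).
have [ex fx] := Ox.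
have [[ey1 fy1] [ez1 fz1]] := (Oy1, Oz1).
have Ox1 : orthTo e f x1.
  by split; rewrite x1E !bilE ?ey1 ?fy1 ?ez1 ?fz1 !mulr0 addr0.
have [ex1 fx1] := Ox1.
have Ox2 : orthTo e f x2 by split; rewrite x2E !bilE ?ex ?fx ?ex1 ?fx1 subrr.
have [ex2 fx2] := Ox2.
have O1 : orthTo y1 z1 x2.
  by split; rewrite x2E x1E !bilE ?(bilC z1 y1) ?yy ?zz ?yz; ring.
have O2 : orthTo y2 z2 x1.
  have [[a b] [c d]] := (O12, O12').
  by split; rewrite x1E !bilE ?(bilC _ y1) ?(bilC _ z1) ?a ?b ?c ?d !mulr0 addr0.
have xE : x = x1 + x2 by rewrite x2E addrC subrK.
have [N1 H1] := egroup_conj_orth_plane M ef yz2 Ox1 Oy2 Oz2 O2 Iy2 Iz2.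
have [N2 H2] := egroup_conj_orth_plane (maxn M N1) ef yz1 Ox2 Oy1 Oz1 O1 Iy1 Iz1.
exists N2 => j w Nj Dw.
have -> : eichler f x *m eichler e w *m eichler f (- x) =
   eichler f x1 *m (eichler f x2 *m eichler e w *m eichler f (- x2)) *m eichler f (- x1).
  have -> : - x = - x2 + - x1 by rewrite xE opprD addrC.
  by rewrite {1}xE -!eichler_add ?bilNr ?fx1 ?fx2 ?oppr0 // !mulmxA.
apply: (egroup_conj (eichlerN ff fx1) (eichlerNl ff fx1) _ _ (H2 j w Nj Dw)).
- by move=> v /deep_le-/(_ N1 (leq_maxr _ _)); apply: H1.
- move=> v [[ev fv] Dv]; rewrite !eichler_add ?bilE ?fv ?fx1 ?oppr0 ?addr0 //.
  rewrite addrAC subrr add0r; apply: egroup_eichler_f.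
  by apply: (deep_le (leq_maxl M N1)); split.
Qed.

Definition lattice_planes e f := exists y1 z1 y2 z2,
  [/\ hypPair y1 z1 /\ hypPair y2 z2,
      [/\ orthTo e f y1, orthTo e f z1, orthTo e f y2 & orthTo e f z2],
      orthTo y1 z1 y2 /\ orthTo y1 z1 z2
    & [/\ IntV y1, IntV z1, IntV y2 & IntV z2]].

Lemma egroup_conj_eichler_f e f M x : hypPair e f -> lattice_planes e f -> orthTo e f x ->
  exists N0, forall g, egroup e f (deep e f N0) g ->
    egroup e f (deep e f M) (eichler f x *m g *m eichler f (- x)).
Proof.
move=> ef [y1 [z1 [y2 [z2 [[h1 h2] [o1 o2 o3 o4] [o5 o6] [I1 I2 I3 I4]]]]]] Ox.
have [N0 H0] := egroup_conj_opposite M ef h1 h2 o1 o2 o3 o4 o5 o6 I1 I2 I3 I4 Ox.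
have [[ee ff _] [ex fx]] := (ef, Ox).
exists (maxn M N0) => g; apply: (egroup_conj (eichlerN ff fx) (eichlerNl ff fx)) => w Dw.
  by apply: (H0 N0) => //; apply: deep_le Dw; apply: leq_maxr.
have [[ew fw] _] := Dw.
rewrite !eichler_add ?bilE ?fx ?fw ?oppr0 ?addr0 // addrAC subrr add0r.
by apply: egroup_eichler_f; apply: deep_le Dw; apply: leq_maxl.
Qed.

Lemma lattice_planes_swap e f : lattice_planes e f -> lattice_planes f e.
Proof.
move=> [y1 [z1 [y2 [z2 [? [[? ?] [? ?] [? ?] [? ?]] ? ?]]]]].
by exists y1, z1, y2, z2.
Qed.

Lemma egroup_conj_eichler_e e f M x : hypPair e f -> lattice_planes e f -> orthTo e f x ->
  exists N0, forall g, egroup e f (deep e f N0) g ->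
    egroup e f (deep e f M) (eichler e x *m g *m eichler e (- x)).
Proof.
move=> /hypPair_swap fe /lattice_planes_swap pl [ex fx].
have [N0 H0] := egroup_conj_eichler_f M fe pl (conj fx ex).
exists N0 => g /egroup_swap Gg; apply/egroup_swap/(egroup_mono (@deep_swap f e M)).
by apply/H0/(egroup_mono _ Gg)/deep_swap.
Qed.

(** * Commutators with isometries congruent to the identity *)
Definition near_one e f j g g' :=
  fixes e f g g' /\ exists2 B : 'M_N, (forall i l, Int (B i l)) & g = 1%:M + s ^+ j *: B.

(** For b with entries that have denominators: the commutator with b sends
    isometries very close to 1 to products of transvections close to 1. *)
Definition commutes_deeply e f b := forall M, exists N0, forall j g g', (N0 <= j)%N ->
  near_one e f j g g' -> forall b', b *m b' = 1%:M ->
  egroup e f (deep e f M) (g *m b *m g' *m b').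

Lemma deep_move e f M w : orthTo e f w -> exists N0, forall j g g',
  (N0 <= j)%N -> near_one e f j g g' -> deep e f M (g *m w - w).
Proof.
move=> [ew fw]; have [k Ik] := IntV_frac w.
exists (M + k)%N => j g g' Mj [[I _ _ ge gf] [B IB gE]]; split.
  split; rewrite !bilE.
    by rewrite -{1}ge bil_iso // ew subrr.
  by rewrite -{1}gf bil_iso // fw subrr.
exists (s ^+ (j - M - k) *: (B *m (s ^+ k *: w))).
  apply: IntVZ; first exact: IntX.
  by move=> i; rewrite mxE; apply: Int_sum => l; apply: IntM.
rewrite gE mulmxDl mul1mx addrC addKr -scalemxAr -scalemxAl !scalerA -!exprD.
by congr (_ ^+ _ *: _); lia.
Qed.

(** From g E(p, w) g^-1 = E(p, g w - w) E(p, w), the commutator of g with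
    E(p, w) k is the product of E(p, g w - w) and the conjugate by E(p, w) of the
    commutator with k.  The dilation makes this conjugate harmless. *)
Lemma commutes_deeply_eichler_mul e f p w k : hypPair e f -> p = e \/ p = f ->
  (forall M x, orthTo e f x -> exists N0, forall g, egroup e f (deep e f N0) g ->
    egroup e f (deep e f M) (eichler p x *m g *m eichler p (- x))) ->
  (forall M v, deep e f M v -> egroup e f (deep e f M) (eichler p v)) ->
  orthTo e f w -> egroup e f (orthTo e f) k ->
  commutes_deeply e f k -> commutes_deeply e f (eichler p w *m k).
Proof.
move=> ef pe conjp genp Ow Gk IH M; have [ee ff _] := ef.
have pp : bil p p = 0 by case: pe => ->.
have pw v : orthTo e f v -> bil p v = 0 by case: pe => -> [].
have [M1 H1] := conjp M w Ow; have [N1 H2] := IH M1.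
have [N2 H3] := deep_move M Ow.
exists (N1 + N2)%N => j g g' Nj nearg eps' V.
have [[I gg' g'g ge gf] _] := nearg.
have [k' _ [kk' k'k]] := egroup_inverse ef Gk.
have -> : eps' = k' *m eichler p (- w).
  have V' : eichler p w *m (k *m eps') = 1%:M by rewrite mulmxA.
  rewrite -[eps' in LHS]mul1mx -k'k -[k in LHS]mul1mx -(eichlerNl pp (pw w Ow)).
  by rewrite -!mulmxA V' mulmx1.
have D : deep e f M (g *m w - w) by apply: (H3 j g g') => //; lia.
have -> : g *m (eichler p w *m k) *m g' *m (k' *m eichler p (- w)) =
   eichler p (g *m w - w) *m (eichler p w *m (g *m k *m g' *m k') *m eichler p (- w)).
  have Dp : bil p (g *m w - w) = 0 by case: D => O _; apply: pw.
  rewrite !mulmxA eichler_add ?(pw w Ow) //.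
  rewrite subrK -[in LHS](mul1mx k) -g'g !mulmxA.
  rewrite (eichler_conj _ _ I gg').
  by have -> : g *m p = p by case: pe => ->.
apply: egroup_mul; first exact: genp.
by apply: H1; apply: (H2 j g g') => //; lia.
Qed.

Lemma egroup_commutes_deeply e f eps : hypPair e f -> lattice_planes e f ->
  egroup e f (orthTo e f) eps -> commutes_deeply e f eps.
Proof.
move=> ef pl; elim=> [|w k Ow Gk IH|w k Ow Gk IH].
- move=> M; exists 0%N => j g g' _ [[_ gg' _ _ _] _] eps'; rewrite mul1mx => ->.
  by rewrite !mulmx1 gg'; apply: egroup1.
- apply: commutes_deeply_eichler_mul => //; first by left.
    by move=> *; apply: egroup_conj_eichler_e.
  by move=> *; apply: egroup_eichler_e.
- apply: commutes_deeply_eichler_mul => //; first by right.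
    by move=> *; apply: egroup_conj_eichler_f.
  by move=> *; apply: egroup_eichler_f.
Qed.

Lemma decomposable_commutes_deeply e f b : hypPair e f -> lattice_planes e f ->
  decomposable e f b -> commutes_deeply e f b.
Proof.
move=> ef pl [eps [rho [rho' [bE Geps [rr r'r] comm _]]]] M.
have [N0 H0] := egroup_commutes_deeply ef pl Geps M.
exists N0 => j g g' Nj nearg b' bb'.
have [Fg _] := nearg; have [_ gg' g'g _ _] := Fg.
have -> : g *m b *m g' *m b' = g *m eps *m g' *m (rho *m b').
  rewrite bE !mulmxA -(mulmxA _ rho g').
  suff -> : rho *m g' = g' *m rho by rewrite !mulmxA.
  by rewrite -[LHS]mul1mx -g'g -(mulmxA g') (mulmxA g) (comm _ _ Fg) -!mulmxA gg' mulmx1.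
by apply: (H0 j g g') => //; rewrite mulmxA -bE.
Qed.

End Dilation.

End Transvections.

(** * Descent from the localization *)
Section Congruence.
Variables (R : comNzRingType) (N : nat) (s : R).
Implicit Types (g h b : 'M[R]_N).

Definition cong1 M g := exists B : 'M[R]_N, g = 1%:M + s ^+ M *: B.

Lemma cong1_one M : cong1 M 1%:M.
Proof. by exists 0; rewrite scaler0 addr0. Qed.

Lemma cong1_mul M g h : cong1 M g -> cong1 M h -> cong1 M (g *m h).
Proof.
move=> [B ->] [C ->]; exists (B + C + s ^+ M *: (B *m C)).
rewrite mulmxDl mul1mx -addrA; congr (_ + _).
by rewrite mulmxDr mulmx1 -scalemxAl -scalemxAr !scalerDr addrA (addrC (_ *: C)).
Qed.

Lemma cong1_inv M g g' : cong1 M g -> g *m g' = 1%:M -> cong1 M g'.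
Proof.
move=> [B gE] gg'; exists (- (B *m g')).
by rewrite -gg' gE mulmxDl mul1mx -scalemxAl scalerN addrK.
Qed.

Lemma cong1_conj M g b b' : cong1 M g -> b *m b' = 1%:M -> cong1 M (b *m g *m b').
Proof.
move=> [B ->] bb'; exists (b *m B *m b').
by rewrite mulmxDr mulmx1 mulmxDl bb' -scalemxAr -scalemxAl.
Qed.

Lemma cong1_le M M' g : (M <= M')%N -> cong1 M' g -> cong1 M g.
Proof.
by move=> MM [B ->]; exists (s ^+ (M' - M) *: B); rewrite scalerA -exprD subnKC.
Qed.

(** The entries of the difference have the form s^M y; if such an entry vanishes
    in the localization, then y is s-torsion, hence killed by s^M. *)
Lemma cong1_inj (S : comNzRingType) (i : {rmorphism R -> S}) M g h :
  (forall r, i r = 0 -> exists k, s ^+ k * r = 0) ->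
  (forall r k, s ^+ k * r = 0 -> s ^+ M * r = 0) ->
  cong1 M g -> cong1 M h -> map_mx i g = map_mx i h -> g = h.
Proof.
move=> iker bound [B ->] [C ->] E; congr (_ + _); apply/matrixP => a c.
apply/eqP; rewrite !mxE -subr_eq0 -mulrBr; apply/eqP.
have : i (s ^+ M * (B a c - C a c)) = 0.
  move/matrixP/(_ a c): E; rewrite !mxE => /eqP.
  rewrite -subr_eq0 -rmorphB => /eqP <-; congr (i _); ring.
by move/iker => [k]; rewrite mulrA -exprD => /bound.
Qed.

Lemma cong1_eichler M (Phi : 'M_N) (half : R) u w :
  cong1 M (eichler Phi half u (s ^+ M *: w)).
Proof.
exists (w *m (u^T *m Phi) - u *m (w^T *m Phi)
  - (s ^+ M * quad Phi half w) *: (u *m (u^T *m Phi))).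
rewrite /eichler quadZ linearZ /= -!scalemxAl -!scalemxAr !scalerBr !scalerA !addrA.
by rewrite expr2 -mulrA.
Qed.

End Congruence.

Section BaseChange.
Variables (R S : comNzRingType) (i : {rmorphism R -> S}) (N : nat).
Variables (Phi : 'M[R]_N) (half : R).
Notation m := (map_mx i).
Notation PhiS := (map_mx i Phi).

Lemma bil_map x y : bil PhiS (m x) (m y) = i (bil Phi x y).
Proof. by rewrite /bil map_trmx -!map_mxM mxE. Qed.

Lemma quad_map x : quad PhiS (i half) (m x) = i (quad Phi half x).
Proof. by rewrite /quad bil_map rmorphM. Qed.

Lemma eichler_map u w :
  m (eichler Phi half u w) = eichler PhiS (i half) (m u) (m w).
Proof.
by rewrite /eichler quad_map !map_mxB map_mxD map_mx1 map_mxZ !map_mxM !map_trmx.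
Qed.

Lemma orthTo_map e f x : orthTo Phi e f x -> orthTo PhiS (m e) (m f) (m x).
Proof. by move=> [ex fx]; split; rewrite bil_map ?ex ?fx rmorph0. Qed.

Lemma hypPair_map e f : hypPair Phi e f -> hypPair PhiS (m e) (m f).
Proof.
by move=> [ee ff ef]; split; rewrite bil_map ?ee ?ff ?ef ?rmorph0 ?rmorph1.
Qed.

Lemma fixes_map e f g g' : fixes Phi e f g g' -> fixes PhiS (m e) (m f) (m g) (m g').
Proof.
move=> [I gg' g'g ge gf]; split.
- by rewrite /isometric map_trmx -!map_mxM I.
- by rewrite -map_mxM gg' map_mx1.
- by rewrite -map_mxM g'g map_mx1.
- by rewrite -map_mxM ge.
- by rewrite -map_mxM gf.
Qed.

Definition image_of (a : S) := exists r, a = i r.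

Lemma lattice_planes_map e f : lattice_planes Phi (fun _ => True) e f ->
  lattice_planes PhiS image_of (m e) (m f).
Proof.
move=> [y1 [z1 [y2 [z2 [[h1 h2] [o1 o2 o3 o4] [o5 o6] _]]]]].
exists (m y1), (m z1), (m y2), (m z2); split; split;
  do ?[exact: hypPair_map | exact: orthTo_map];
  by move=> k; rewrite mxE; eexists.
Qed.

Hypothesis PhiT : Phi^T = Phi.
Variables (e f : 'cV[R]_N) (s : R).
Hypothesis ef : hypPair Phi e f.

(** A lift of w0 need not be orthogonal to e and f, as s-torsion may appear, but
    the projection along e and f is defined over R and repairs this. *)
Lemma orthTo_lift w0 : orthTo PhiS (m e) (m f) (m w0) ->
  exists2 w1, orthTo Phi e f w1 & m w0 = m w1.
Proof.
have [ee ff e1] := ef; rewrite /orthTo !bil_map => -[ew fw].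
exists (w0 - bil Phi f w0 *: e - bil Phi e w0 *: f).
  by split; rewrite !bilE ?(bilC PhiT f e) ?ee ?ff ?e1; ring.
by rewrite !map_mxB !map_mxZ ew fw !scale0r !subr0.
Qed.

Lemma egroup_lift (t : S) M g : i s * t = 1 ->
  egroup PhiS (i half) (m e) (m f) (deep PhiS image_of (i s) (m e) (m f) M) g ->
  exists eps, [/\ egroup Phi half e f (orthTo Phi e f) eps, m eps = g & cong1 s M eps].
Proof.
move=> st.
have lift w : deep PhiS image_of (i s) (m e) (m f) M w ->
    exists w1, [/\ orthTo Phi e f w1, orthTo Phi e f (s ^+ M *: w1) & w = m (s ^+ M *: w1)].
  move=> [Ow [w0 Iw0 wE]].
  have Ow0 : orthTo PhiS (m e) (m f) w0.
    apply: (@deep_orth _ _ _ (i s) _ _ _ M); last by rewrite -wE.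
    by exists t.
  have [w00 w0E] := fin_all_exists Iw0.
  have E : w0 = m (\col_k w00 k) by apply/colP => k; rewrite !mxE w0E.
  have [w1 Ow1 E1] : exists2 w1, orthTo Phi e f w1 & m (\col_k w00 k) = m w1.
    by apply: orthTo_lift; rewrite -E.
  have [ew fw] := Ow1.
  exists w1; split=> //; first by split; rewrite bilZr ?ew ?fw mulr0.
  by rewrite wE E E1 map_mxZ rmorphXn.
elim=> [|w k /lift[w1 [Ow1 Ow ->]] _ [eps [G E C]]|w k /lift[w1 [Ow1 Ow ->]] _ [eps [G E C]]].
- by exists 1%:M; rewrite map_mx1; split=> //; [exact: egroup1 | exact: cong1_one].
- exists (eichler Phi half e (s ^+ M *: w1) *m eps); split.
  + exact: egroup_e.
  + by rewrite map_mxM eichler_map E.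
  + by apply: cong1_mul => //; apply: cong1_eichler.
- exists (eichler Phi half f (s ^+ M *: w1) *m eps); split.
  + exact: egroup_f.
  + by rewrite map_mxM eichler_map E.
  + by apply: cong1_mul => //; apply: cong1_eichler.
Qed.

End BaseChange.

(** Over R_s the commutator is a product of transvections divisible by s^M0; these
    lift to R, and the lift equals the commutator because both are congruent to 1
    modulo s^M0. *)
Lemma commutator_near_one (R : comNzRingType) (N : nat) (Phi : 'M[R]_N) (half : R)
    (e f : 'cV[R]_N) (b b' : 'M[R]_N) (s : R) (M0 : nat) :
  Phi^T = Phi -> 2 * half = 1 -> hypPair Phi e f ->
  lattice_planes Phi (fun _ => True) e f -> b *m b' = 1%:M ->
  (forall r k, s ^+ k * r = 0 -> s ^+ M0 * r = 0) ->
  (forall (S : comNzRingType) (i : {rmorphism R -> S}) t, i s * t = 1 ->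
    decomposable (map_mx i Phi) (i half) (map_mx i e) (map_mx i f) (map_mx i b)) ->
  exists N0, forall g g', fixes Phi e f g g' -> cong1 s N0 g ->
    egroup Phi half e f (orthTo Phi e f) (g *m b *m g' *m b').
Proof.
move=> PhiT half2 ef pl bb' bound dec.
(* For s nilpotent the localization is zero, but then g = 1. *)
have [[k sk]|snil] := pselect (exists k, s ^+ k = 0).
  exists k => g g' [_ gg' _ _ _] [B gE].
  have g1 : g = 1%:M by rewrite gE sk scale0r addr0.
  by move: gg'; rewrite g1 mul1mx => ->; rewrite mul1mx mulmx1 bb'; apply: egroup1.
have snz k : s ^+ k != 0 by apply/eqP => sk; apply: snil; exists k.
have [S [i [t [st frac iker]]]] := localization_exists snz.
have PhiST : (map_mx i Phi)^T = map_mx i Phi by rewrite map_trmx PhiT.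
have half2S : 2 * i half = 1 by rewrite -(rmorph_nat i 2) -rmorphM half2 rmorph1.
have bbS : map_mx i b *m map_mx i b' = 1%:M by rewrite -map_mxM bb' map_mx1.
have [||||||||N0 H0] := @decomposable_commutes_deeply _ _ _ _ PhiST half2S (image_of i)
  (i s) _ _ _ _ _ _ _ _ _ _ _ (hypPair_map i ef) (lattice_planes_map i pl) (dec S i t st) M0.
- by exists 1; rewrite rmorph1.
- by move=> _ _ [x ->] [y ->]; exists (x - y); rewrite rmorphB.
- by move=> _ _ [x ->] [y ->]; exists (x * y); rewrite rmorphM.
- by exists half.
- by exists s.
- by move=> j l; rewrite mxE; eexists.
- by move=> a; have [k [r E]] := frac a; exists k, r.
- by exists t.
exists (N0 + M0)%N => g g' Fg Cg.
have [B gE] := Cg; have [_ gg' g'g _ _] := Fg.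
have near : near_one (map_mx i Phi) (image_of i) (i s) (map_mx i e) (map_mx i f)
    (N0 + M0) (map_mx i g) (map_mx i g').
  split; first exact: fixes_map.
  exists (map_mx i B); first by move=> j l; rewrite mxE; eexists.
  by rewrite gE map_mxD map_mx1 map_mxZ rmorphXn.
have [eps [Geps epsE Ceps]] := egroup_lift PhiT ef st (H0 _ _ _ (leq_addr _ _) near _ bbS).
suff -> : g *m b *m g' *m b' = eps by [].
apply: (cong1_inj iker bound) => //; last by rewrite epsE !map_mxM.
have {}Cg : cong1 s M0 g by apply: cong1_le Cg; apply: leq_addl.
rewrite -mulmxA -mulmxA; apply: cong1_mul => //; rewrite mulmxA; apply: cong1_conj => //.
exact: cong1_inv Cg gg'.
Qed.

(** * Elimination by reflections, without denominators *)
Section Descent.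
Variables (R : comNzRingType) (N : nat) (Phi : 'M[R]_N) (half : R).
Hypothesis PhiT : Phi^T = Phi.
Hypothesis half2 : 2 * half = 1.
Variables (e f : 'cV[R]_N) (b : 'M[R]_N).
Hypothesis ef : hypPair Phi e f.
Notation bil := (bil Phi).
Notation qf := (quad Phi half).
Implicit Types (v x y : 'cV[R]_N) (M : 'M[R]_N) (d c : R).

(** The matrix M stands for the isometry M / d over the localization at d. *)
Definition similitude d M := forall x y, bil (M *m x) (M *m y) = d ^+ 2 * bil x y.

(** The pair (M, d) is a stage of the elimination applied to [b]: after inversion
    of d, the isometry b is M / d up to a product of reflections. *)
Definition reached d M := forall (S : comNzRingType) (i : {rmorphism R -> S}) t,
  i d * t = 1 -> exists2 w,
    decomposable (map_mx i Phi) (i half) (map_mx i e) (map_mx i f) w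
    & map_mx i b = w *m (t *: map_mx i M).

(** The reflection in v multiplied by q(v), which removes its denominator. *)
Definition num_refl v : 'M[R]_N := (qf v)%:M - v *m (v^T *m Phi).

Lemma num_reflE v x : num_refl v *m x = qf v *: x - bil v x *: v.
Proof. by rewrite mulmxBl mul_scalar_mx mul_outer. Qed.

Lemma similitude_num_refl d M v :
  similitude d M -> similitude (qf v * d) (num_refl v *m M).
Proof.
move=> simM x y; rewrite -!mulmxA !num_reflE !bilE simM (quad2 Phi half2) (bilC PhiT _ v); ring.
Qed.

Lemma similitude_refl d M c x : c * qf x = 1 ->
  similitude d M -> similitude d (refl Phi c x *m M).
Proof.
by move=> cx simM y z; rewrite -!mulmxA bil_iso ?simM //; apply: refl_isometric cx.
Qed.

Let half2S (S : comNzRingType) (i : {rmorphism R -> S}) : 2 * i half = 1.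
Proof. by rewrite -(rmorph_nat i 2) -rmorphM half2 rmorph1. Qed.

Let PhiST (S : comNzRingType) (i : {rmorphism R -> S}) : (map_mx i Phi)^T = map_mx i Phi.
Proof. by rewrite map_trmx PhiT. Qed.

Lemma refl_map (S : comNzRingType) (i : {rmorphism R -> S}) c v :
  map_mx i (refl Phi c v) = refl (map_mx i Phi) (i c) (map_mx i v).
Proof. by rewrite /refl map_mxB map_mx1 map_mxZ !map_mxM map_trmx. Qed.

(** The orthogonality to e and f is only required up to d: this is what can be
    proved over R, and it suffices over a ring where d is invertible. *)
Lemma reached_num_refl d M v : reached d M ->
  d * bil e v = 0 -> d * bil f v = 0 -> reached (qf v * d) (num_refl v *m M).
Proof.
move=> reM ev fv S i t; rewrite rmorphM => tE.
have dt : i d * (i (qf v) * t) = 1 by rewrite mulrA (mulrC (i d)).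
have [w Dw wE] := reM S i _ dt.
have cancel a : d * a = 0 -> i a = 0.
  move=> da; rewrite -[LHS]mul1r -dt -mulrA mulrC -!mulrA.
  by rewrite mulrCA [i a * _]mulrC -rmorphM da rmorph0 !mulr0.
have cv : (i d * t) * quad (map_mx i Phi) (i half) (map_mx i v) = 1.
  by rewrite quad_map -tE; ring.
exists (w *m refl (map_mx i Phi) (i d * t) (map_mx i v)).
  apply: decomposable_mul => //; apply: (decomposable_refl (PhiST i) (half2S i)) => //.
    exact: hypPair_map.
  by split; rewrite bil_map cancel.
have -> : t *: map_mx i (num_refl v *m M) =
    refl (map_mx i Phi) (i d * t) (map_mx i v) *m ((i (qf v) * t) *: map_mx i M).
  rewrite map_mxM /num_refl map_mxB map_scalar_mx !map_mxM -map_trmx.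
  rewrite -scalemxAr !scalemxAl; congr (_ *m _).
  rewrite /refl !scalerBr scalerA; congr (_ - _ *: _).
    by rewrite scale_scalar_mx scalemx1 mulrC.
  by rewrite -[LHS]mulr1 -tE; ring.
by rewrite wE -mulmxA (mulmxA (refl _ _ _) (refl _ _ _)) (refl_invol (half2S i) cv) mul1mx.
Qed.

Lemma reached_refl d M c x : reached d M -> orthTo Phi e f x -> c * qf x = 1 ->
  reached d (refl Phi c x *m M).
Proof.
move=> reM Ox cx S i t dt; have [w Dw wE] := reM S i t dt.
have cv : i c * quad (map_mx i Phi) (i half) (map_mx i x) = 1.
  by rewrite quad_map -rmorphM cx rmorph1.
exists (w *m refl (map_mx i Phi) (i c) (map_mx i x)).
  apply: decomposable_mul => //; apply: (decomposable_refl (PhiST i) (half2S i)) => //.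
    exact: hypPair_map.
  exact: orthTo_map.
rewrite map_mxM refl_map wE -mulmxA scalemxAr.
by rewrite (mulmxA (refl _ _ _) (refl _ _ _)) (refl_invol (half2S i) cv) mul1mx.
Qed.

Variable Q : R -> Prop.
Hypothesis QD : forall r s, Q r -> Q s -> Q (r + s).
Hypothesis QM : forall a r, Q r -> Q (a * r).
Hypothesis QX : forall r k, Q (r ^+ k) -> Q r.
Hypothesis Q_dec : forall s, (forall (S : comNzRingType) (i : {rmorphism R -> S}) t,
  i s * t = 1 ->
  decomposable (map_mx i Phi) (i half) (map_mx i e) (map_mx i f) (map_mx i b)) -> Q s.

(** The vectors of [ys] are already fixed by M / d, those of [xs] are to be
    treated.  For the next x, the vectors v1 = M x - d x and v2 = M x + d x are
    orthogonal to [ys] up to d, the reflection in v1 maps M x to d x, and the one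
    in v2 maps it to - d x, which the reflection in x corrects.  Since
    q(v1) + q(v2) = 4 d^2 q(x), if both q(v1) d and q(v2) d satisfy Q, then so
    does d^3, and hence d. *)
Lemma reached_descent (xs ys : seq 'cV[R]_N) d M :
  similitude d M -> reached d M ->
  e \in ys -> f \in ys -> (forall y, y \in ys -> M *m y = d *: y) ->
  pairwise (fun x y => bil x y == 0) xs ->
  (forall x y, x \in xs -> y \in ys -> bil x y = 0) ->
  (forall x, x \in xs -> exists c, c * qf x = 1) ->
  (forall d' M', (forall y, y \in ys -> M' *m y = d' *: y) ->
    (forall x, x \in xs -> M' *m x = d' *: x) -> M' = d'%:M) ->
  Q d.
Proof.
elim: xs ys d M => [|x xs IH] ys d M simM reM eys fys fixM orth orthy unitx span.
  apply: Q_dec => S i t dt; have [w Dw ->] := reM S i t dt.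
  by rewrite (span d M fixM) // map_scalar_mx scale_scalar_mx mulrC dt mulmx1.
have xx : x \in x :: xs by rewrite mem_head.
have [c cx] := unitx x xx.
move: orth; rewrite pairwise_cons => /andP[/allP orthx orth].
have xy y : y \in ys -> bil x y = 0 by apply: orthy.
have dMxy y : y \in ys -> d * bil (M *m x) y = 0.
  by move=> yys; rewrite -bilZr -fixM // simM xy // mulr0.
have next M' q : similitude (q * d) M' -> reached (q * d) M' ->
    (forall y, y \in ys -> M' *m y = (q * d) *: y) -> M' *m x = (q * d) *: x ->
    Q (q * d).
  move=> simM' reM' fixM' fixx; apply: (IH (x :: ys) _ M') => //; rewrite ?inE ?eys ?fys ?orbT //.
  - by move=> y; rewrite inE => /predU1P[->|/fixM'].
  - move=> x' y x'xs; rewrite inE => /predU1P[->|yys].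
      by rewrite bilC //; apply/eqP/orthx.
    by apply: orthy => //; rewrite inE x'xs orbT.
  - by move=> x' x'xs; apply: unitx; rewrite inE x'xs orbT.
  - move=> d' M1 H1 H2; apply: span.
      by move=> y yys; apply: H1; rewrite inE yys orbT.
    by move=> x'; rewrite inE => /predU1P[->|/H2 //]; apply: H1; rewrite mem_head.
have Ox : orthTo Phi e f x by split; rewrite bilC // xy.
have qx : bil x x = 2 * qf x by rewrite -quad2.
have [r rE] : exists r, r = bil (M *m x) x by eexists.
have rE' : bil x (M *m x) = r by rewrite bilC.
have quadM : qf (M *m x) = d ^+ 2 * qf x by rewrite /quad simM; ring.
have [v1 v1E] : exists v, v = M *m x - d *: x by eexists.
have [v2 v2E] : exists v, v = M *m x + d *: x by eexists.
have q1 : qf v1 = 2 * d ^+ 2 * qf x - d * r.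
  by rewrite v1E !(quadD PhiT half2) quadN quadZ quadM bilNr bilZr -rE; ring.
have q2 : qf v2 = 2 * d ^+ 2 * qf x + d * r.
  by rewrite v2E !(quadD PhiT half2) quadZ quadM bilZr -rE; ring.
have v1y y : y \in ys -> d * bil v1 y = 0.
  by move=> yys; rewrite v1E bilDl bilNl bilZl xy // mulr0 subr0 dMxy.
have v2y y : y \in ys -> d * bil v2 y = 0.
  by move=> yys; rewrite v2E bilDl bilZl xy // mulr0 addr0 dMxy.
have fix_num v y : y \in ys -> d * bil v y = 0 -> num_refl v *m M *m y = (qf v * d) *: y.
  by move=> yys vy; rewrite -mulmxA fixM // num_reflE bilZr vy scale0r subr0 scalerA.
have Q1 : Q (qf v1 * d).
  apply: (next (num_refl v1 *m M)).
  - exact: similitude_num_refl.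
  - by apply: reached_num_refl => //; rewrite bilC // v1y.
  - by move=> y yys; apply: fix_num => //; apply: v1y.
  - rewrite -mulmxA num_reflE.
    have -> : bil v1 (M *m x) = qf v1.
      by rewrite q1 v1E bilDl bilNl bilZl simM rE' qx; ring.
    by rewrite -scalerBr v1E subKr scalerA.
have Q2 : Q (qf v2 * d).
  have fix_refl y : y \in ys -> refl Phi c x *m y = y.
    by move=> yys; rewrite reflE xy // mulr0 scale0r subr0.
  apply: (next (refl Phi c x *m (num_refl v2 *m M))).
  - by apply: similitude_refl => //; apply: similitude_num_refl.
  - by apply: reached_refl => //; apply: reached_num_refl => //; rewrite bilC // v2y.
  - move=> y yys; rewrite -mulmxA fix_num //; last exact: v2y.
    by rewrite -scalemxAr fix_refl.
  - rewrite -!mulmxA num_reflE.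
    have -> : bil v2 (M *m x) = qf v2.
      by rewrite q2 v2E bilDl bilZl simM rE' qx; ring.
    rewrite -scalerBr v2E opprD addrA subrr add0r -!scalemxAr mulmxN -scalemxAr reflE qx.
    have -> : c * (2 * qf x) = 2 by rewrite mulrCA cx mulr1.
    by apply/colP => k; rewrite !mxE; ring.
apply: (QX (k := 3)).
have -> : d ^+ 3 = (half ^+ 2 * c) * (qf v1 * d + qf v2 * d).
  rewrite q1 q2; transitivity ((2 * half) ^+ 2 * (c * qf x) * d ^+ 3); last by ring.
  by rewrite half2 cx; ring.
by apply: QM; apply: QD.
Qed.

End Descent.

(** * Patching along the path *)
Lemma expr_sum_split (R : comNzRingType) (r s : R) n1 n2 :
  exists X Y, (r + s) ^+ (n1 + n2) = r ^+ n1 * X + s ^+ n2 * Y.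
Proof.
move En : (n1 + n2)%N => n; elim: n n1 n2 En => [|n IH] [|n1] [|n2] //= En.
- by exists 1, 0; rewrite mulr0 addr0 !expr0 mulr1.
- by exists ((r + s) ^+ n.+1), 0; rewrite mulr0 addr0 mul1r.
- by exists 0, ((r + s) ^+ n.+1); rewrite mulr0 add0r mul1r.
- have [X [Y E1]] := IH n1 n2.+1 ltac:(lia).
  have [X' [Y' E2]] := IH n1.+1 n2 ltac:(lia).
  exists (X + s * X'), (r * Y + Y').
  by rewrite exprS mulrDl {1}E1 E2 !exprS; ring.
Qed.

Lemma egroup_fixes_conj (R : comNzRingType) (N : nat) (Phi : 'M[R]_N) (half : R)
    (e f : 'cV[R]_N) (g g' h : 'M[R]_N) :
  fixes Phi e f g g' -> egroup Phi half e f (orthTo Phi e f) h ->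
  egroup Phi half e f (orthTo Phi e f) (g *m h *m g').
Proof.
move=> [I gg' g'g ge gf].
have O w : orthTo Phi e f w -> orthTo Phi e f (g *m w).
  by move=> [ew fw]; split; [rewrite -{1}ge|rewrite -{1}gf]; rewrite bil_iso.
apply: egroup_conj => // w Ow; rewrite eichler_conj // ?ge ?gf.
  by apply: egroup_eichler_e; apply: O.
by apply: egroup_eichler_f; apply: O.
Qed.

(** The commutator of a product, in the form needed for a group normalised by
    g1. *)
Lemma commutator_mul (R : comNzRingType) (N : nat) (g1 g1' g2 g2' b b' : 'M[R]_N) :
  g1' *m g1 = 1%:M -> b' *m b = 1%:M ->
  g1 *m g2 *m b *m (g2' *m g1') *m b' =
  (g1 *m (g2 *m b *m g2' *m b') *m g1') *m (g1 *m b *m g1' *m b').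
Proof.
move=> V W; rewrite !mulmxA -(mulmxA _ g1' g1) V mulmx1.
by rewrite -(mulmxA _ b' b) W mulmx1.
Qed.

(** The s-power torsion is an ideal, and finitely many generators are killed by a
    common power of s. *)
Lemma noetherian_torsion_bounded (R : comNzRingType) (s : R) : noetherian R ->
  exists M0, forall r k, s ^+ k * r = 0 -> s ^+ M0 * r = 0.
Proof.
move=> hR.
have [l lP] : exists l : seq R, forall x : R, (exists k, s ^+ k * x = 0) <->
    exists c : 'I_(size l) -> R, x = \sum_(i < size l) c i * l`_i.
  apply: hR; split.
  - by exists 0%N; rewrite mulr0.
  - move=> x y [k xk] [k' yk]; exists (k + k')%N.
    have -> : s ^+ (k + k') * (x + y) = s ^+ k' * (s ^+ k * x) + s ^+ k * (s ^+ k' * y).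
      by rewrite exprD; ring.
    by rewrite xk yk !mulr0 addr0.
  - by move=> a x [k xk]; exists k; rewrite mulrCA xk mulr0.
have lk (i : 'I_(size l)) : exists k, s ^+ k * l`_i = 0.
  apply/lP; exists (fun j => (j == i)%:R); rewrite (bigD1 i) //= eqxx mul1r.
  by rewrite big1 ?addr0 // => j /negPf ->; rewrite mul0r.
have [k kP] := fin_all_exists lk.
exists (\max_i k i)%N => r j rj.
have [c ->] : exists c : 'I_(size l) -> R, r = \sum_(i < size l) c i * l`_i.
  by apply/lP; exists j.
rewrite mulr_sumr big1 // => i _.
have ki : (k i <= \max_i k i)%N by apply: leq_bigmax.
by rewrite -(subnK ki) exprD -mulrA (mulrCA _ (c i)) kP !mulr0.
Qed.

(** The abstract form of the theorem.  The hypothesis on the family [G] is the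
    continuity of a polynomial path for the s-adic topologies, and [xs] is an
    orthogonal basis of V with unit norms. *)
Lemma commutator_path (R : comNzRingType) (N : nat) (Phi : 'M[R]_N) (half : R)
    (e f : 'cV[R]_N) (b b' : 'M[R]_N) (xs : seq 'cV[R]_N) (G G' : R -> 'M[R]_N) :
  noetherian R -> Phi^T = Phi -> 2 * half = 1 -> hypPair Phi e f ->
  lattice_planes Phi (fun _ => True) e f -> fixes Phi e f b b' ->
  pairwise (fun x y => bil Phi x y == 0) xs ->
  (forall x, x \in xs -> orthTo Phi e f x) ->
  (forall x, x \in xs -> exists c, c * quad Phi half x = 1) ->
  (forall (d : R) M, M *m e = d *: e -> M *m f = d *: f ->
    (forall x, x \in xs -> M *m x = d *: x) -> M = d%:M) ->
  (forall a, fixes Phi e f (G a) (G' a)) ->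
  (forall s k a c, cong1 s k (G (a + s ^+ k * c) *m G' a)) ->
  G 0 = 1%:M ->
  egroup Phi half e f (orthTo Phi e f) (G 1 *m b *m G' 1 *m b').
Proof.
move=> hR PhiT half2 ef pl Fb orth Oxs unitx span FG contG G0.
have [Ib bb' b'b be bf] := Fb.
(* s is good: a step of size s^k c from a changes the commutator within the group *)
pose Q s := exists k, forall a c, egroup Phi half e f (orthTo Phi e f)
  (G (a + s ^+ k * c) *m G' a *m b *m (G a *m G' (a + s ^+ k * c)) *m b').
have FGG a1 a2 : fixes Phi e f (G a2 *m G' a1) (G a1 *m G' a2).
  have [I1 V1 V1' e1 f1] := FG a1; have [I2 V2 V2' e2 f2] := FG a2.
  have I1' : isometric Phi (G' a1).
    rewrite /isometric -[in LHS]I1 !mulmxA -trmx_mul V1 trmx1 mul1mx.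
    by rewrite -mulmxA V1 mulmx1.
  split.
  - exact: isometric_mul.
  - by rewrite mulmxA -(mulmxA (G a2)) V1' mulmx1.
  - by rewrite mulmxA -(mulmxA (G a1)) V2' mulmx1.
  - by rewrite -mulmxA -{1}e1 (mulmxA (G' a1)) V1' mul1mx.
  - by rewrite -mulmxA -{1}f1 (mulmxA (G' a1)) V1' mul1mx.
have QD r s : Q r -> Q s -> Q (r + s).
  move=> [k1 H1] [k2 H2]; exists (k1 + k2)%N => a c.
  have [X [Y ->]] := expr_sum_split r s k1 k2.
  (* the step is split in two, through the intermediate parameter a1 *)
  pose a1 := a + r ^+ k1 * (X * c).
  have -> : a + (r ^+ k1 * X + s ^+ k2 * Y) * c = a1 + s ^+ k2 * (Y * c).
    by rewrite /a1; ring.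
  set a2 := a1 + _.
  have [_ V1 V1' _ _] := FG a1.
  have -> : G a2 *m G' a = (G a2 *m G' a1) *m (G a1 *m G' a).
    by rewrite mulmxA -(mulmxA (G a2)) V1' mulmx1.
  have -> : G a *m G' a2 = (G a *m G' a1) *m (G a1 *m G' a2).
    by rewrite mulmxA -(mulmxA (G a)) V1' mulmx1.
  have [_ _ V _ _] := FGG a1 a2.
  rewrite commutator_mul //; apply: egroup_mul; last exact: H2.
  by apply: egroup_fixes_conj => //; apply: H1.
have QM a r : Q r -> Q (a * r).
  move=> [k H]; exists k => a0 c; have -> : (a * r) ^+ k * c = r ^+ k * (a ^+ k * c).
    by rewrite exprMn; ring.
  exact: H.
have QX r k : Q (r ^+ k) -> Q r.
  by move=> [l H]; exists (k * l)%N => a c; rewrite exprM; apply: H.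
have Q_dec s : (forall (S : comNzRingType) (i : {rmorphism R -> S}) t, i s * t = 1 ->
    decomposable (map_mx i Phi) (i half) (map_mx i e) (map_mx i f) (map_mx i b)) -> Q s.
  move=> dec; have [M0 bound] := noetherian_torsion_bounded s hR.
  have [k H] := commutator_near_one PhiT half2 ef pl bb' bound dec.
  by exists k => a c; apply: H.
suff [k H] : Q 1.
  have := H 0 1; rewrite expr1n mulr1 add0r G0 mul1mx.
  have [_ _ V _ _] := FG 0; move: V; rewrite G0 mulmx1 => ->.
  by rewrite mulmx1.
apply: (@reached_descent _ _ _ _ PhiT half2 _ _ b ef Q QD QM QX Q_dec xs [:: e; f] 1 b) => //.
- by move=> x y; rewrite bil_iso // expr1n mul1r.
- move=> S i t; rewrite rmorph1 mul1r => ->; exists 1%:M; first exact: decomposable1.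
  by rewrite scale1r mul1mx.
- by rewrite !inE eqxx.
- by rewrite !inE eqxx orbT.
- by move=> y; rewrite !inE => /orP[] /eqP ->; rewrite scale1r.
- move=> x y /Oxs [ex fx]; rewrite !inE => /orP[] /eqP ->; by rewrite bilC.
- move=> d M Hef Hxs; apply: span => //; apply: Hef; rewrite !inE eqxx ?orbT //.
Qed.

(** * The split form in coordinates *)

(** Coordinates are counted from 0 here: coordinate 0 is the anisotropic one, and
    2i - 1 and 2i, for i > 0, span a hyperbolic plane. *)
Definition partner (k : nat) : nat := if odd k then k.+1 else k.-1.

Definition oform_entry (k l : nat) : nat :=
  if k == 0%N then (l == 0%N).*2 else l == partner k.

Lemma partnerK k : (0 < k)%N -> partner (partner k) = k.
Proof.
rewrite /partner; case: k => // k _ /=.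
by case ok : (odd k) => /=; rewrite ok.
Qed.

Lemma partner_gt0 k : (0 < k)%N -> (0 < partner k)%N.
Proof. by rewrite /partner; case: k => [|[|k]] //= _; case: ifP. Qed.

Lemma oform_entryC k l : oform_entry k l = oform_entry l k.
Proof.
rewrite /oform_entry; case: k l => [|k] [|l] //=.
- by rewrite (ltn_eqF (partner_gt0 _)).
- by rewrite (ltn_eqF (partner_gt0 _)).
- by congr (nat_of_bool _); apply/eqP/eqP => ->; rewrite partnerK.
Qed.

Section Coordinates.
Variable A : comNzRingType.

Definition oform (n : nat) : 'M[A]_n := \matrix_(i, j) (oform_entry i j)%:R.

(** The index is a natural number, so that index arithmetic does not disturb
    types; the vector is zero for an index out of range. *)
Definition unitv (n k : nat) : 'cV[A]_n := \col_i (i == k :> nat)%:R.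

Lemma phi_form_even_entry r (i j : 'I_(r.*2)) :
  phi_form_even A r i j = (j == (if odd i then i.-1 else i.+1) :> nat)%:R.
Proof.
rewrite /phi_form_even summxE.
transitivity (\sum_(1 <= k < r.+1) ((((i.+1 == 2 * k - 1) && (j.+1 == 2 * k)) +
   ((i.+1 == 2 * k) && (j.+1 == 2 * k - 1)))%N%:R : A)).
  by apply: eq_bigr => k _; rewrite !mxE natrD.
rewrite -natr_sum; congr (_%:R).
have [ir jr] := (ltn_ord i, ltn_ord j).
move: (i : nat) (j : nat) ir jr => {i j} i j ir jr.
transitivity (((i < r.*2)%N && (j == (if odd i then i.-1 else i.+1))) : nat); last by rewrite ir.
elim: r {ir jr} => [|r IH]; first by rewrite big_geq.
rewrite big_nat_recr //= IH; case oi : (odd i); lia.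
Qed.

Lemma phi_formE n : odd n -> phi_form A n = oform n.
Proof.
move=> on; apply/matrixP => i j; rewrite castmxE mxE /perp.
have oi : odd n = 1%N :> nat by rewrite on.
have small (k : 'I_(odd n)) : k = 0%N :> nat by have := ltn_ord k; lia.
rewrite /block_mx !mxE.
case: splitP => k /= kE; rewrite !mxE; case: splitP => l /= lE;
  rewrite ?mxE ?phi_form_even_entry kE lE ?small ?oi ?add1n /oform_entry //=.
- by rewrite -val_eqE /= !small.
- suff -> : (0%N == partner k.+1) = false by [].
  by rewrite /partner; case: (k : nat) => // k'; case: ifP.
- rewrite /partner /=; congr (_%:R).
  by case: (k : nat) => [|k'] //=; case: (odd k') => /=; rewrite ?eqSS.
Qed.

Lemma partner_lt n k : odd n -> (0 < k < n)%N -> (0 < partner k < n)%N.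
Proof. by rewrite /partner => on kn; case ok : (odd k); lia. Qed.

Lemma unitv_delta n (i : 'I_n) : unitv n i = delta_mx i 0.
Proof. by apply/matrixP => k l; rewrite !mxE ord1 eqxx andbT. Qed.

Lemma bil_unitv n k l : (k < n)%N -> (l < n)%N ->
  bil (oform n) (unitv n k) (unitv n l) = (oform_entry k l)%:R.
Proof.
move=> kn ln; rewrite (unitv_delta (Ordinal kn)) (unitv_delta (Ordinal ln)).
by rewrite /bil trmx_delta -rowE -colE !mxE.
Qed.

Lemma oform_sym n : odd n -> (oform n)^T = oform n.
Proof.
move=> on; apply/matrixP => i j; rewrite !mxE; congr (_%:R).
exact: oform_entryC.
Qed.

Lemma unitvT_oform n k : odd n -> (k < n)%N ->
  (unitv n k)^T *m oform n =
    if k == 0%N then 2 *: (unitv n 0)^T else (unitv n (partner k))^T.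
Proof.
move=> on kn; rewrite (unitv_delta (Ordinal kn)) trmx_delta -rowE.
apply/rowP => j; rewrite !mxE /oform_entry /=; case: k kn => [|k] kn /=.
  by rewrite !mxE; case: (j == 0%N :> nat); rewrite ?mulr1 ?mulr0.
by rewrite !mxE.
Qed.

Lemma bil_unitv_coord n k (w : 'cV_n) (i : 'I_n) : odd n -> (0 < k < n)%N ->
  i = partner k :> nat -> bil (oform n) (unitv n k) w = w i 0.
Proof.
move=> on /andP[k0 kn] iE; rewrite /bil unitvT_oform // (gtn_eqF k0) -iE unitv_delta.
by rewrite trmx_delta -rowE mxE.
Qed.

Lemma unitv_sum n (w : 'cV_n) : w = \sum_(i < n) w i 0 *: unitv n i.
Proof.
apply/colP => i; rewrite summxE (bigD1 i) //= !mxE eqxx mulr1 big1 ?addr0 //.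
by move=> j ji; rewrite !mxE -val_eqE eq_sym in ji *; rewrite (negPf ji) mulr0.
Qed.

Lemma mx_eq_unitv n (M M' : 'M_n) :
  (forall k, (k < n)%N -> M *m unitv n k = M' *m unitv n k) -> M = M'.
Proof.
move=> E; apply: mx_ext => x; rewrite (unitv_sum x) !mulmx_sumr; apply: eq_bigr => i _.
by rewrite -!scalemxAr E.
Qed.

End Coordinates.

Section OddForm.
Variables (A : comNzRingType) (half : A) (n : nat).
Hypothesis half2 : 2 * half = 1.
Hypothesis n_odd : odd n.
Hypothesis n_ge5 : (5 <= n)%N.
Notation Phi := (oform A (n + 2)).
Notation v := (unitv A (n + 2)).

Let N_odd : odd (n + 2). Proof. by rewrite oddD n_odd. Qed.

Lemma hypPair_unitv k : odd k -> (k.+1 < n + 2)%N -> hypPair Phi (v k) (v k.+1).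
Proof.
move=> ok kn; split; rewrite bil_unitv ?(ltnW kn) // /oform_entry /partner /= ?ok /=.
- by case: k ok kn => //= k _ _; rewrite eqn_leq ltnn andbF.
- by rewrite eqn_leq ltnn.
- by case: k ok kn => //= k _ _; rewrite eqxx.
Qed.

Lemma orthTo_unitv k l : odd k -> (k.+1 < n + 2)%N -> (l < n + 2)%N ->
  l != k -> l != k.+1 -> orthTo Phi (v k) (v k.+1) (v l).
Proof.
move=> ok kn ln lk lk1; split; rewrite bil_unitv ?(ltnW kn) // /oform_entry /partner /= ?ok /=.
  by case: k ok kn lk lk1 => //= k _ _ _ /negPf ->.
by rewrite (negPf lk).
Qed.

Lemma lattice_planes_unitv : lattice_planes Phi (fun _ => True) (v n) (v n.+1).
Proof.
exists (v 1%N), (v 2%N), (v 3%N), (v 4%N); split; split => //;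
  try (by apply: hypPair_unitv => //; lia); by apply: orthTo_unitv => //; lia.
Qed.

(** The orthogonal basis of V: the anisotropic vector, and for each hyperbolic
    plane the sum and the difference of its two isotropic basis vectors, of norms
    1 and - 1. *)
Definition orth_basis (k : nat) : 'cV[A]_(n + 2) :=
  if k == 0%N then v 0 else if odd k then v k + v k.+1 else v k.-1 - v k.

Lemma orth_basis_orthTo k : (k < n)%N -> orthTo Phi (v n) (v n.+1) (orth_basis k).
Proof.
move=> kn.
have O l : (l < n)%N -> orthTo Phi (v n) (v n.+1) (v l).
  by move=> ln; apply: orthTo_unitv => //; lia.
rewrite /orth_basis; case: eqP => [_|k0]; first by apply: O; lia.
case ok : (odd k).
  have [|a b] := O k; first by lia.
  have [|a' b'] := O k.+1; first by lia.
  by split; rewrite bilE ?a ?b ?a' ?b' addr0.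
have [|a b] := O k; first by lia.
have [|a' b'] := O k.-1; first by lia.
by split; rewrite !bilE ?a ?b ?a' ?b' subr0.
Qed.

Lemma orth_basis_quad k : (k < n)%N -> exists c, c * quad Phi half (orth_basis k) = 1.
Proof.
move=> kn; rewrite /orth_basis /quad; case: eqP => [_|k0].
  by exists 1; rewrite bil_unitv /oform_entry /= ?mul1r 1?mulrC //; lia.
case ok : (odd k).
  have [|kk kk1 k1] := hypPair_unitv ok; first by lia.
  exists 1; rewrite !bilE kk kk1 k1 (bilC (oform_sym A N_odd) (v k.+1)) k1.
  by transitivity (2 * half); [ring | exact: half2].
have ok1 : odd k.-1 by move: ok k0; case: (k) => //= k' /negbFE.
have kE : k.-1.+1 = k by lia.
have [|kk kk1 k1] := hypPair_unitv ok1; first by lia.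
move: kk1 k1; rewrite kE => kk1 k1.
exists (-1); rewrite !bilE kk kk1 k1 (bilC (oform_sym A N_odd) (v k)) k1.
by transitivity (2 * half); [ring | exact: half2].
Qed.

Lemma orth_basis_plane k : (0 < k < n)%N -> exists a, [/\ odd a, (a.+1 < n)%N &
  (k = a /\ orth_basis k = v a + v a.+1) \/ (k = a.+1 /\ orth_basis k = v a - v a.+1)].
Proof.
move=> /andP[k0 kn]; rewrite /orth_basis (gtn_eqF k0).
case ok : (odd k); first by exists k; split=> //; [lia | left].
have kE : k.-1.+1 = k by lia.
exists k.-1; rewrite kE; split=> //; last by right.
by move: ok; rewrite -kE /= => /negbFE.
Qed.

Lemma orth_basis_orth k l : (k < l < n)%N -> bil Phi (orth_basis k) (orth_basis l) = 0.
Proof.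
move=> /andP[kl ln].
have C := bilC (oform_sym A N_odd).
have [|a [oa an la]] := @orth_basis_plane l; first by lia.
have O b : (b < n)%N -> b != a -> b != a.+1 ->
    bil Phi (v b) (v a) = 0 /\ bil Phi (v b) (v a.+1) = 0.
  by move=> bn ba ba1; have [||E1 E2] := orthTo_unitv oa _ _ ba ba1; rewrite ?(C (v b)) //; lia.
case: (posnP k) kl => [->|k0] kl.
  have [|||Ea Ea1] := O 0%N; [lia.. |].
  by rewrite {1}/orth_basis /=; case: la => -[_ ->]; rewrite !bilE Ea Ea1; ring.
have [|c [oc cn kc]] := @orth_basis_plane k; first by lia.
have [ca|ca] := eqVneq c a.
  have [|aa aa1 a1] := hypPair_unitv oa; first by lia.
  case: kc => -[kE ->]; case: la => -[lE ->]; subst c; rewrite ?kE ?lE in kl; try lia.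
  by rewrite !bilE aa aa1 a1 (C (v a.+1)) a1; ring.
have [|||Ea Ea1] := O c; [lia | by [] | by lia |].
have [|||Eb Eb1] := O c.+1; [lia | by lia | by lia |].
by case: kc => -[_ ->]; case: la => -[_ ->]; rewrite !bilE Ea Ea1 Eb Eb1; ring.
Qed.

Lemma orth_basis_span (d : A) M : M *m v n = d *: v n -> M *m v n.+1 = d *: v n.+1 ->
  (forall k, (k < n)%N -> M *m orth_basis k = d *: orth_basis k) -> M = d%:M.
Proof.
move=> He Hf Hx; apply: mx_eq_unitv => k kN; rewrite mul_scalar_mx.
have pair a : odd a -> (a.+1 < n)%N ->
    M *m v a = d *: v a /\ M *m v a.+1 = d *: v a.+1.
  move=> oa an; have := Hx a (ltnW an); have := Hx a.+1 an.
  rewrite /orth_basis /= oa /=; case: a oa an => //= a oa an E1 E2.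
  have E (x y : 'cV[A]_(n + 2)) : 2 *: x = 2 *: y -> x = y.
    by move/(congr1 (fun z => half *: z)); rewrite !scalerA mulrC half2 !scale1r.
  move: E1 E2; rewrite mulmxBr mulmxDr.
  set X := M *m v a.+1; set Y := M *m v a.+2; move: X Y => X Y E1 E2.
  split; apply: E; apply/colP => i; move/colP/(_ i): E1; move/colP/(_ i): E2; rewrite !mxE => E2 E1.
    by transitivity (X i 0 - Y i 0 + (X i 0 + Y i 0)); [ring | rewrite E1 E2; ring].
  by transitivity (X i 0 + Y i 0 - (X i 0 - Y i 0)); [ring | rewrite E1 E2; ring].
have [kn|kn] := ltnP k n.
  have [->|k0] := posnP k; first by apply: (Hx 0%N); lia.
  have [|a [oa an ka]] := @orth_basis_plane k; first by lia.
  by have [P1 P2] := pair a oa an; case: ka => -[-> _].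
by have [->|->] : k = n \/ k = n.+1 by lia.
Qed.

End OddForm.

(** * Transvections along the last plane are elementary *)
Section ElementaryGenerators.
Variables (A : comUnitRingType) (half : A) (n : nat).
Hypothesis half2 : 2 * half = 1.
Hypothesis n_odd : odd n.
Notation Phi := (oform A (n + 2)).
Notation v := (unitv A (n + 2)).
Notation tau := (eichler Phi half).

Let N_odd : odd (n + 2). Proof. by rewrite oddD n_odd. Qed.

Let N_gt0 : (0 < n + 2)%N. Proof. by rewrite addn2. Qed.

Let PhiT := oform_sym A N_odd.

Lemma mxunit_unitv (a b : nat) : mxunit A (n + 2) a.+1 b.+1 = v a *m (v b)^T.
Proof.
by apply/matrixP => i j; rewrite !mxE big_ord1 !mxE !eqSS -natrM mulnb.
Qed.

Lemma bil_unitv00 : bil Phi (v 0) (v 0) = 2.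
Proof. by rewrite bil_unitv. Qed.

Lemma eichler_unitv k (z : A) : (0 < k < n + 2)%N ->
  tau (v k) (z *: v 0) = 1%:M + z *: mxunit A (n + 2) 1 (partner k).+1
    - (2 * z) *: mxunit A (n + 2) k.+1 1 - z ^+ 2 *: mxunit A (n + 2) k.+1 (partner k).+1.
Proof.
move=> /andP[k0 kn]; rewrite /eichler !mxunit_unitv quadZ /quad bil_unitv00 (mulrC half) half2 mulr1.
have -> : (z *: v 0)^T *m Phi = (2 * z) *: (v 0)^T.
  by rewrite linearZ /= -scalemxAl unitvT_oform // eqxx scalerA mulrC.
by rewrite unitvT_oform // (gtn_eqF k0) -scalemxAl -scalemxAr.
Qed.

(** The generators F^1_i and F^2_i, according to the parity of the position k of
    the isotropic vector. *)
Lemma in_EO_eichler_short k (z : A) : (0 < k < n + 2)%N -> in_EO (tau (v k) (z *: v 0)).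
Proof.
move=> /andP[k0 kn]; rewrite eichler_unitv ?k0 //.
case ok : (odd k).
  have -> : partner k = k.+1 by rewrite /partner ok.
  have := @EO_F1 A (n + 2) k.+1./2 z; rewrite /F1.
  have -> : (2 * k.+1./2 = k.+1)%N by rewrite mul2n; have := odd_double_half k.+1; rewrite /= ok; lia.
  by rewrite addn1; apply; lia.
have -> : partner k = k.-1 by rewrite /partner ok.
have := @EO_F2 A (n + 2) k./2 z; rewrite /F2.
have -> : (2 * k./2 = k)%N by rewrite mul2n; have := odd_double_half k; rewrite /= ok; lia.
by rewrite prednK // addn1; apply; lia.
Qed.

(** E(v k, a v 0) maps v 0 to v 0 - 2 a v k and fixes v p.  So conjugating
    E(v p, v 0) by it multiplies it by E(v p, - 2 a v k). *)
Lemma in_EO_eichler_long p k (z : A) : (0 < p < n + 2)%N -> (0 < k < n + 2)%N ->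
  k != p -> k != partner p -> in_EO (tau (v p) (z *: v k)).
Proof.
move=> pn kn kp kp'.
have [/andP[p0 pn'] /andP[k0 kn']] := (pn, kn).
have self j : (0 < j < n + 2)%N -> bil Phi (v j) (v j) = 0.
  move=> /andP[j0 jn]; rewrite bil_unitv // /oform_entry (gtn_eqF j0).
  by rewrite /partner; case: (odd j); rewrite ?(ltn_eqF (ltnSn _)) // gtn_eqF // prednK.
have v0 j : (0 < j < n + 2)%N -> bil Phi (v j) (v 0) = 0.
  by move=> /andP[j0 jn]; rewrite bil_unitv // /oform_entry (gtn_eqF j0) ltn_eqF ?partner_gt0.
have pk : bil Phi (v p) (v k) = 0.
  by rewrite bil_unitv // /oform_entry (gtn_eqF p0) (negPf kp').
pose a := - half * z.
have ka : bil Phi (v k) (a *: v 0) = 0 by rewrite bilZr v0 ?mulr0.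
have pz : bil Phi (v p) (z *: v k) = 0 by rewrite bilZr pk mulr0.
have pv0 := v0 p pn.
have vkp : bil Phi (v k) (v p) = 0 by rewrite (bilC PhiT).
have av0p : bil Phi (a *: v 0) (v p) = 0 by rewrite bilZl (bilC PhiT) pv0 mulr0.
have gp : tau (v k) (a *: v 0) *m v p = v p.
  by rewrite eichlerE vkp av0p mulr0 !scale0r addr0 !subr0.
have g0 : tau (v k) (a *: v 0) *m v 0 = v 0 + z *: v k.
  rewrite eichlerE v0 // bilZl bil_unitv00 mulr0 !scale0r addr0 subr0 -scaleNr.
  congr (_ + _ *: _); transitivity (2 * half * z); first by rewrite /a; ring.
  by rewrite half2 mul1r.
have E : tau (v k) (a *: v 0) *m tau (v p) (1 *: v 0) *m tau (v k) (- a *: v 0) =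
    tau (v p) (1 *: v 0) *m tau (v p) (z *: v k).
  have I := eichler_isometric PhiT half2 (self k kn) ka.
  have V := eichlerN PhiT half2 (self k kn) ka.
  rewrite scale1r scaleNr (eichler_conj half _ _ I V) gp g0.
  by rewrite (eichler_add PhiT half2 (self p pn) pv0 pz).
have -> : tau (v p) (z *: v k) = tau (v p) (- 1 *: v 0) *m
    (tau (v k) (a *: v 0) *m tau (v p) (1 *: v 0) *m tau (v k) (- a *: v 0)).
  by rewrite E mulmxA scale1r scaleN1r (eichlerNl PhiT half2 (self p pn) pv0) mul1mx.
by do !apply: EO_mul; apply: in_EO_eichler_short.
Qed.

Lemma in_EO_eichler_plane p w : p = n \/ p = n.+1 -> orthTo Phi (v n) (v n.+1) w ->
  in_EO (tau (v p) w).
Proof.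
move=> pE [nw n1w].
have n0 : (0 < n)%N by case: (n) n_odd.
have pn : (0 < p < n + 2)%N by case: pE => ->; lia.
have [P1 P2] : partner n = n.+1 /\ partner n.+1 = n by rewrite /partner /= n_odd.
have PP : partner p = n \/ partner p = n.+1 by case: pE => ->; rewrite ?P1 ?P2; [right|left].
pose X x := bil Phi (v p) x = 0 /\ in_EO (tau (v p) x).
have pp : bil Phi (v p) (v p) = 0.
  by have [a b _] := @hypPair_unitv A n n n_odd ltac:(lia); case: pE => ->.
have X0 : X 0 by split; rewrite ?bil0r // eichler0; apply: EO_1.
suff [] : X w by [].
rewrite (unitv_sum w); apply: (big_ind X) => //.
  move=> x y [px Ex] [py Ey]; split; first by rewrite bilDr px py addr0.
  by rewrite -(eichler_add PhiT half2 pp px py); apply: EO_mul.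
move=> i _; have [iltn|nlei] := ltnP i n.
  have pi0 : bil Phi (v p) (v i) = 0.
    rewrite bil_unitv // ?/oform_entry; last by case/andP: pn.
    by rewrite gtn_eqF ?ltn_eqF //; [case: PP => -> | case/andP: pn]; lia.
  split; first by rewrite bilZr pi0 mulr0.
  have [i0|i0] := posnP i; first by rewrite i0; apply: in_EO_eichler_short.
  by apply: in_EO_eichler_long => //; [lia | case: pE => -> | case: PP => ->]; lia.
suff -> : w i 0 = 0 by rewrite scale0r.
have [iE|iE] : i = n :> nat \/ i = n.+1 :> nat by have := ltn_ord i; lia.
  by rewrite -n1w; apply/esym/bil_unitv_coord; rewrite ?P2 //; lia.
by rewrite -nw; apply/esym/bil_unitv_coord; rewrite ?P1 //; lia.
Qed.

Lemma in_EO_egroup g :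
  egroup Phi half (v n) (v n.+1) (orthTo Phi (v n) (v n.+1)) g -> in_EO g.
Proof.
elim=> [|w h Ow _ IH|w h Ow _ IH]; first exact: EO_1.
  by apply: EO_mul => //; apply: in_EO_eichler_plane => //; left.
by apply: EO_mul => //; apply: in_EO_eichler_plane => //; right.
Qed.

End ElementaryGenerators.

(** * Stabilization and the theorem *)
Section Stabilization.
Variables (A : comNzRingType) (n : nat).
Hypothesis n_odd : odd n.

Definition stab (M : 'M[A]_n) : 'M[A]_(n + 2) := perp M (1%:M : 'M[A]_2).

Lemma stab_mul M M' : stab M *m stab M' = stab (M *m M').
Proof. by rewrite /stab /perp mulmx_block !mulmx0 !mul0mx !addr0 !add0r mul1mx. Qed.

Lemma stab1 : stab 1%:M = 1%:M.
Proof. by rewrite /stab /perp -scalar_mx_block. Qed.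

Lemma oform_block :
  oform A (n + 2) = perp (oform A n) (\matrix_(i, j) (i != j)%:R : 'M_2).
Proof.
apply/matrixP => i j; rewrite /perp /block_mx !mxE.
have far a c : (a < n)%N -> oform_entry a (n + c) = 0%N.
  move=> an; rewrite /oform_entry; have [_|a0] := posnP a.
    by rewrite addn_eq0; case: eqP => // n0; move: an; rewrite n0.
  have /andP[_ pn] : (0 < partner a < n)%N by apply: partner_lt; rewrite ?a0.
  by rewrite gtn_eqF // (leq_trans pn) // leq_addr.
case: splitP => k kE; rewrite !mxE; case: splitP => l lE; rewrite !mxE kE lE //.
- by rewrite far.
- by rewrite oform_entryC far.
- have n0 : (n == 0)%N = false by case: (n) n_odd.
  rewrite /oform_entry addn_eq0 n0 /= /partner oddD n_odd /= -val_eqE /=.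
  congr (_%:R); case: k {kE} => -[|[|//]] _ /=; case: l {lE} => -[|[|//]] _ /=; lia.
Qed.

Lemma stab_unitv k M : (k < 2)%N ->
  stab M *m unitv A (n + 2) (n + k) = unitv A (n + 2) (n + k).
Proof.
move=> k2; have -> : unitv A (n + 2) (n + k) = col_mx 0 (unitv A 2 k).
  apply/colP => i; rewrite !mxE; case: splitP => j ->; rewrite !mxE ?eqn_add2l //.
  by rewrite ltn_eqF //; apply: leq_trans (ltn_ord j) (leq_addr _ _).
by rewrite /stab /perp mul_block_col !mulmx0 mul0mx !add0r mul1mx.
Qed.

Lemma stab_fixes M M' : M^T *m oform A n *m M = oform A n ->
  M *m M' = 1%:M -> M' *m M = 1%:M ->
  fixes (oform A (n + 2)) (unitv A (n + 2) n) (unitv A (n + 2) n.+1) (stab M) (stab M').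
Proof.
move=> I V V'; split; rewrite ?stab_mul ?V ?V' ?stab1 //.
- rewrite /isometric oform_block /stab /perp tr_block_mx !trmx0 trmx1 !mulmx_block.
  by rewrite !mulmx0 !mul0mx !addr0 !add0r !mul1mx !mulmx1 I !mul0mx.
- by have := @stab_unitv 0%N M isT; rewrite addn0.
- by have := @stab_unitv 1%N M isT; rewrite addn1.
Qed.

End Stabilization.

(** The s-adic continuity of polynomial functions. *)
Lemma horner_shift (A : comNzRingType) (p : {poly A}) a h :
  exists q, p.[a + h] = p.[a] + h * q.
Proof.
elim/poly_ind: p => [|p c [q E]]; first by exists 0; rewrite !horner0 mulr0 addr0.
exists (p.[a] + q * (a + h)); rewrite !hornerMXaddC E; ring.
Qed.

Lemma map_oform (A B : comNzRingType) (i : {rmorphism A -> B}) n :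
  map_mx i (oform A n) = oform B n.
Proof. by apply/matrixP => k l; rewrite !mxE rmorph_nat. Qed.

Theorem theorem1p6 (R : comUnitRingType) (hR : noetherian R)
    (h2 : (2 : R) \is a GRing.unit)
    (m : nat) (hm : (3 <= m)%N)
    (alpha : 'M[R]_(2 * m - 1)) (halpha : in_SO alpha)
    (hhom : homotopic_to_id alpha)
    (beta : 'M[R]_(2 * m - 1)) (hbeta : in_O beta) :
  in_EO (perp (commutator alpha beta) (1%:M : 'M[R]_2)).
Proof.
have n_odd : odd (2 * m - 1) by rewrite oddB ?mul2n ?odd_double //; lia.
have n5 : (5 <= 2 * m - 1)%N by lia.
move: (2 * m - 1)%N n_odd n5 alpha halpha hhom beta hbeta => n n_odd n5 alpha _.
move=> [P [[[[P' [PP' P'P]] PI] _] P0 P1]] beta [[beta' [bb' b'b]] bI].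
have half2 : 2 * (2^-1 : R) = 1 by rewrite divrr.
have invE (M M' : 'M[R]_n) : M *m M' = 1%:M -> invmx M = M'.
  move=> V; have [Mu _] := mulmx1_unit V.
  by rewrite -[LHS]mulmx1 -V mulmxA mulVmx // mul1mx.
pose ev a : {rmorphism {poly R} -> R} := horner_eval a.
pose G a := stab (map_mx (ev a) P); pose G' a := stab (map_mx (ev a) P').
have evV a : map_mx (ev a) P *m map_mx (ev a) P' = 1%:M by rewrite -map_mxM PP' map_mx1.
have evV' a : map_mx (ev a) P' *m map_mx (ev a) P = 1%:M by rewrite -map_mxM P'P map_mx1.
have FG a : fixes (oform R (n + 2)) (unitv R (n + 2) n) (unitv R (n + 2) n.+1) (G a) (G' a).
  apply: stab_fixes => //.
  by rewrite -(map_oform (ev a)) map_trmx -!map_mxM -phi_formE // PI.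
have Fb : fixes (oform R (n + 2)) (unitv R (n + 2) n) (unitv R (n + 2) n.+1)
    (stab beta) (stab beta').
  by apply: stab_fixes => //; rewrite -phi_formE.
suff : in_EO (G 1 *m stab beta *m G' 1 *m stab beta').
  rewrite !stab_mul /commutator (invE _ _ bb').
  have alphaE : map_mx (ev 1) P = alpha by rewrite -P1.
  by rewrite -alphaE (invE _ _ (evV 1)).
apply: (in_EO_egroup half2 n_odd).
apply: (@commutator_path _ _ _ _ _ _ _ _ [seq orth_basis R n k | k <- iota 0 n] G G') => //.
- by apply: oform_sym; rewrite oddD n_odd.
- by apply: hypPair_unitv => //; lia.
- exact: lattice_planes_unitv.
- rewrite pairwise_map; apply/(pairwiseP 0%N) => k l.
  rewrite !inE !size_iota => kn ln kl; rewrite /= !nth_iota // !add0n.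
  by apply/eqP/orth_basis_orth => //; rewrite kl.
- move=> x /mapP[k]; rewrite mem_iota add0n => /= kn ->.
  exact: orth_basis_orthTo.
- move=> x /mapP[k]; rewrite mem_iota add0n => /= kn ->.
  exact: orth_basis_quad.
- move=> d M He Hf Hx; apply: (orth_basis_span half2) => // k kn.
  by apply: Hx; apply: map_f; rewrite mem_iota add0n.
- move=> s k a c.
  have step (i j : 'I_n) : exists q, (P i j).[a + s ^+ k * c] = (P i j).[a] + s ^+ k * q.
    by have [q E] := horner_shift (P i j) a (s ^+ k * c); exists (c * q); rewrite E mulrA.
  have [D DE] := fin_all_exists (fun i => fin_all_exists (step i)).
  have E : map_mx (ev (a + s ^+ k * c)) P = map_mx (ev a) P + s ^+ k *: \matrix_(i, j) D i j.
    by apply/matrixP => i j; rewrite !mxE; apply: DE.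
  exists (block_mx ((\matrix_(i, j) D i j) *m map_mx (ev a) P') 0 0 0).
  rewrite stab_mul E mulmxDl evV -scalemxAl -stab1 /stab /perp.
  by rewrite scale_block_mx add_block_mx !scaler0 !addr0.
- by rewrite /G P0 stab1.
Qed.
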